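(* Let $F$ be an infinite field of characteristic $p>2$, let $A = F\langle Y,Z\rangle$ be the free $2$-graded unital associative $F$-algebra on even generators $Y=\{y_1,y_2,\dots\}$ and odd generators $Z=\{z_1,z_2,\dots\}$, and let $B = A/U$ where $U = (T\cap I_p)+I_{p+1}$ (with $T$ and $I_k$ as defined in the context). Then the algebra $C_2(B)$ of all $2$-graded central polynomials of $B$ is not finitely generated as a $T_2$-subalgebra in $A$; that is, there is no finite subset $S\subset C_2(B)$ such that $C_2(B)$ is the minimal $T_2$-subalgebra of $A$ containing $S$.
   Context: Algebras are unital associative $F$-algebras. ''$2$-graded'' means $(\mathbb Z/2\mathbb Z)$-graded: $G=G_0\oplus G_1$ with $G_hG_{h'}\subseteq G_{h+h'}$; elements of $G_0$ are called even and elements of $G_1$ odd. $A=F\langle Y,Z\rangle$ is the free unital associative $F$-algebra with free generating set $Y\cup Z$, where $Y=\{y_1,y_2,\dots\}$ and $Z=\{z_1,z_2,\dots\}$. It is $2$-graded by declaring each $y_i$ even and each $z_j$ odd: $A_0$ (resp. $A_1$) is the linear span of the monomials containing an even (resp. odd) number of letters from $Z$, counted with multiplicity. Commutators: $[a,b]=ab-ba$ and $[a,b,c]=[[a,b],c]$. $T$ is the two-sided ideal of $A$ generated by all $[a_1,a_2,a_3]$ with $a_1,a_2,a_3\in A$. For $k\ge 0$, $A^{(k)}$ is the linear span of all monomials in the $y_i,z_j$ whose total degree in the variables $z_1,z_2,\dots$ is $k$; so $A=\bigoplus_{i\ge 0}A^{(i)}$. For $k\ge1$, $I_k=\sum_{i\ge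 k}A^{(i)}$. The ideal $U=(T\cap I_p)+I_{p+1}$ is a $2$-graded ideal of $A$, and $B=A/U$ carries the inherited $2$-grading $B_0=(A_0+U)/U$, $B_1=(A_1+U)/U$. A $2$-graded endomorphism of $A$ is a (unital) algebra endomorphism $\phi$ with $\phi(A_0)\subseteq A_0$ and $\phi(A_1)\subseteq A_1$. A subalgebra $V$ of $A$ is a $T_2$-subalgebra if $\phi(V)\subseteq V$ for all $2$-graded endomorphisms $\phi$ of $A$. A subset $S$ generates a $T_2$-subalgebra $V$ as a $T_2$-subalgebra if $V$ is the minimal $T_2$-subalgebra of $A$ containing $S$. For a $2$-graded unital algebra $G=G_0\oplus G_1$, a polynomial $f(y_1,y_2,\dots;z_1,z_2,\dots)\in A$ is a $2$-graded central polynomial of $G$ if $f(g_1,g_2,\dots;g_1',g_2',\dots)$ is central in $G$ for all $g_1,g_2,\dots\in G_0$ and all $g_1',g_2',\dots\in G_1$. The set $C_2(G)$ of all $2$-graded central polynomials of $G$ is a $T_2$-subalgebra of $A$. *)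

(* Defs.v *)
From HB Require Import structures.
From mathcomp Require Import all_boot all_algebra.
From mathcomp Require Import finmap boolp classical_sets cardinality.
From mathcomp Require Import monalg.

Set Implicit Arguments.
Unset Strict Implicit.
Unset Printing Implicit Defensive.

Import GRing.Theory.
Local Open Scope ring_scope.
Local Open Scope classical_set_scope.
Local Open Scope quotient_scope.

(* The library's idealr is a proper additive subgroup closed under left
   multiplication, and its ring quotient is restricted to commutative rings.
   We add closure under right multiplication and form the quotient algebra. *)
HB.mixin Record isRightMulClosed (R : nzRingType) (S : R -> bool) := {
  rmul_closed_subproof : forall a, {in S, forall u, u * a \in S}
}.

#[short(type="properIdeal")]
HB.structure Definition TwoSidedIdeal (R : nzRingType) :=
  {S of Idealr R S & isRightMulClosed R S}.

Section QuotientAlgebra.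
Variables (F : fieldType) (R : algType F) (I : properIdeal R).

Definition algQuot := Quotient.quot I.

HB.instance Definition _ := GRing.Zmodule.on algQuot.
HB.instance Definition _ := @EqQuotient.on algQuot.
HB.instance Definition _ :=
  @isZmodQuotient.Build R (Quotient.equiv I) 0 -%R +%R algQuot
    (lock _) (@Quotient.pi_opp _ I) (@Quotient.pi_add _ I).

Definition algQuot_pi (x : R) : algQuot := \pi_algQuot x.
Local Notation pi := algQuot_pi.

Fact algQuot_piP (x y : R) : reflect (pi x = pi y) (x - y \in I).
Proof. by rewrite Quotient.idealrBE; apply: eqP. Qed.

Let piE (x : algQuot) : pi (repr x) = x. Proof. exact: reprK. Qed.

Let repr_pi (x : R) : repr (pi x) - x \in I.
Proof. by apply/algQuot_piP; rewrite piE. Qed.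

Let piD (x y : R) : pi (x + y) = pi x + pi y.
Proof. exact: Quotient.pi_add. Qed.

Definition algQuot_one : algQuot := \pi_algQuot 1.
Definition algQuot_mul (x y : algQuot) : algQuot :=
  \pi_algQuot (repr x * repr y).
Definition algQuot_scale (c : F) (x : algQuot) : algQuot :=
  \pi_algQuot (c *: repr x).

Let piM (x y : R) : pi (x * y) = algQuot_mul (pi x) (pi y).
Proof.
apply/esym/algQuot_piP.
have -> : repr (pi x) * repr (pi y) - x * y
        = repr (pi x) * (repr (pi y) - y) + (repr (pi x) - x) * y.
  by rewrite mulrBr mulrBl addrA subrK.
rewrite rpredD //; first by rewrite idealMr // repr_pi.
exact/rmul_closed_subproof/repr_pi.
Qed.

Let piZ c (x : R) : pi (c *: x) = algQuot_scale c (pi x).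
Proof.
apply/esym/algQuot_piP; rewrite -scalerBr -[_ - _]mul1r scalerAl.
exact/idealMr/repr_pi.
Qed.

Let mulA : associative algQuot_mul.
Proof.
by move=> x y z; rewrite -[x]piE -[y]piE -[z]piE -!piM mulrA.
Qed.

Let mul1 : left_id algQuot_one algQuot_mul.
Proof. by move=> x; rewrite -[x]piE -piM mul1r. Qed.

Let mulq1 : right_id algQuot_one algQuot_mul.
Proof. by move=> x; rewrite -[x]piE -piM mulr1. Qed.

Let mulDl : left_distributive algQuot_mul +%R.
Proof.
by move=> x y z; rewrite -[x]piE -[y]piE -[z]piE -piD -!piM -piD mulrDl.
Qed.

Let mulDr : right_distributive algQuot_mul +%R.
Proof.
by move=> x y z; rewrite -[x]piE -[y]piE -[z]piE -piD -!piM -piD mulrDr.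
Qed.

Let one_neq0 : algQuot_one != 0.
Proof.
have -> : (0 : algQuot) = pi 0 by apply: (addrI (pi 0)); rewrite addr0 -piD addr0.
by apply/eqP => /algQuot_piP; rewrite subr0 idealr1.
Qed.

HB.instance Definition _ := GRing.Zmodule_isNzRing.Build algQuot
  mulA mul1 mulq1 mulDl mulDr one_neq0.

Let scaleA a b v :
  algQuot_scale a (algQuot_scale b v) = algQuot_scale (a * b) v.
Proof. by rewrite -[v]piE -!piZ scalerA. Qed.

Let scale1 : left_id 1 algQuot_scale.
Proof. by move=> v; rewrite -[v]piE -piZ scale1r. Qed.

Let scaleDr : right_distributive algQuot_scale +%R.
Proof.
by move=> a u v; rewrite -[u]piE -[v]piE -piD -!piZ -piD scalerDr.
Qed.

Let scaleDl v : {morph algQuot_scale^~ v : a b / a + b}.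
Proof. by move=> a b; rewrite -[v]piE -!piZ -piD scalerDl. Qed.

HB.instance Definition _ := GRing.Zmodule_isLmodule.Build F algQuot
  scaleA scale1 scaleDr scaleDl.

Let scaleAl a (u v : algQuot) : a *: (u * v) = (a *: u) * v.
Proof.
rewrite -[u]piE -[v]piE /GRing.scale /= /GRing.mul /=.
by rewrite -piM -!piZ -piM scalerAl.
Qed.

HB.instance Definition _ := GRing.Lmodule_isLalgebra.Build F algQuot scaleAl.

Let scaleAr a (u v : algQuot) : a *: (u * v) = u * (a *: v).
Proof.
rewrite -[u]piE -[v]piE /GRing.scale /= /GRing.mul /=.
by rewrite -piM -!piZ -piM scalerAr.
Qed.

HB.instance Definition _ := GRing.Lalgebra_isAlgebra.Build F algQuot scaleAr.

Fact algQuot_pi_is_linear : linear algQuot_pi.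
Proof. by move=> c x y; rewrite piD piZ. Qed.

Fact algQuot_pi_is_monoid_morphism : GRing.monoid_morphism algQuot_pi.
Proof. exact: (conj erefl piM). Qed.

HB.instance Definition _ :=
  GRing.isLinear.Build F R algQuot _ algQuot_pi algQuot_pi_is_linear.
HB.instance Definition _ :=
  GRing.isMonoidMorphism.Build R algQuot algQuot_pi algQuot_pi_is_monoid_morphism.

End QuotientAlgebra.

(* Free generators: [inl i] is the even variable y_(i+1), [inr j] is the odd
   variable z_(j+1). *)
Definition var : Type := (nat + nat)%type.
HB.instance Definition _ := Choice.on var.

Definition is_odd_var (v : var) : bool := if v is inr _ then true else false.

(* Elements of [{fmonom var}] are words in the variables, so the monoid algebra
   over it is the free unital associative algebra F<Y,Z>. *)
Definition freeAlg (F : fieldType) := {malg F[{fmonom var}]}.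
HB.instance Definition _ (F : fieldType) := GRing.Lalgebra.on (freeAlg F).

Fact freeAlg_scalerAr (F : fieldType) (c : F) (a b : freeAlg F) :
  c *: (a * b) = a * (c *: b).
Proof.
apply/malgP => m; rewrite mcoeffZ (mcoeffMrw m (fsubset_refl _) (msuppZ_le c b)).
rewrite (mcoeffMrw m (fsubset_refl _) (fsubset_refl _)).
rewrite mulr_sumr; apply: eq_bigr => i _; rewrite mulr_sumr; apply: eq_bigr => j _.
by rewrite mcoeffZ -mulrnAr mulrnAr mulrCA mulrnAr.
Qed.
HB.instance Definition _ (F : fieldType) :=
  GRing.Lalgebra_isAlgebra.Build F (freeAlg F) (@freeAlg_scalerAr F).

Section Definitions.
Variable F : fieldType.
Local Notation A := (freeAlg F).

Definition monomial (m : {fmonom var}) : A := mkmalgU m 1.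

Definition zdeg (m : {fmonom var}) : nat := count is_odd_var m.

Definition lspan (S : set A) : set A :=
  smallest (fun V : set A => GRing.submod_closed [in V]) S.

Definition A_even : set A := lspan [set monomial m | m in [set m | ~~ odd (zdeg m)]].
Definition A_odd : set A := lspan [set monomial m | m in [set m | odd (zdeg m)]].

Definition A_deg (k : nat) : set A :=
  lspan [set monomial m | m in [set m | zdeg m = k]].

Definition I_ (k : nat) : set A :=
  lspan (\bigcup_(i in [set i | (k <= i)%N]) A_deg i).

Definition is_ideal (I : set A) : Prop :=
  GRing.zmod_closed [in I] /\ forall a u, I u -> I (a * u) /\ I (u * a).

Definition comm2 (a b : A) : A := a * b - b * a.
Definition comm3 (a b c : A) : A := comm2 (comm2 a b) c.

Definition T : set A :=
  smallest is_ideal [set x | exists a b c, x = comm3 a b c].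

Definition U (p : nat) : set A :=
  [set x + y | x in T `&` I_ p & y in I_ p.+1].

Definition graded_endo (phi : {lrmorphism A -> A}) : Prop :=
  phi @` A_even `<=` A_even /\ phi @` A_odd `<=` A_odd.

Definition T2_subalgebra (V : set A) : Prop :=
  GRing.subalg_closed [in V] /\
  forall phi : {lrmorphism A -> A}, graded_endo phi -> phi @` V `<=` V.

Definition T2_generated (S : set A) : set A := smallest T2_subalgebra S.

Definition T2_finitely_generated (V : set A) : Prop :=
  exists S : set A, [/\ finite_set S, S `<=` V & T2_generated S = V].

Definition eval_word (G : algType F) (g g' : nat -> G) (w : {fmonom var}) : G :=
  \prod_(v <- w) match v with inl i => g i | inr j => g' j end.

(* f(g_1, g_2, ...; g'_1, g'_2, ...), extending [eval_word] linearly *)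
Definition evaluate (G : algType F) (g g' : nat -> G) (f : A) : G :=
  mmap (GRing.in_alg G) (eval_word g g') f.

Definition C2 (G : algType F) (G0 G1 : set G) : set A :=
  [set f | forall g g' : nat -> G,
     (forall i, G0 (g i)) -> (forall j, G1 (g' j)) ->
     forall x, GRing.comm (evaluate g g' f) x].

End Definitions.

Arguments monomial : clear implicits.
Arguments A_even : clear implicits.
Arguments A_odd : clear implicits.
Arguments A_deg : clear implicits.
Arguments I_ : clear implicits.
Arguments T : clear implicits.
Arguments U : clear implicits.

Section IdealU.
Variable F : fieldType.
Local Notation A := (freeAlg F).

Fact lspan_submod (S : set A) : GRing.submod_closed [in lspan S].
Proof.
split; first by apply/mem_set => V [[V0 _] _]; apply/set_mem.
move=> c x y /set_mem Sx /set_mem Sy; apply/mem_set => V VS.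
by apply/set_mem/VS.1.2; apply/mem_set; [apply: Sx | apply: Sy].
Qed.

Fact supp_submod (P : {fmonom var} -> Prop) :
  GRing.submod_closed [in [set a : A | forall m, a@_m != 0 -> P m]].
Proof.
split; first by apply/mem_set => m; rewrite mcoeff0 eqxx.
move=> c x y /set_mem Px /set_mem Py; apply/mem_set => m.
rewrite mcoeffD mcoeffZ; have [x0|/Px //] := eqVneq x@_m 0.
by rewrite x0 mulr0 add0r => /Py.
Qed.

Fact lspan_mulr (S : set A) (c : F) (x : A) : lspan S x -> lspan S (c *: x).
Proof.
have [S0 SL] := lspan_submod S.
by move=> Sx; apply/set_mem; rewrite -[_ *: _]addr0; apply: SL => //; apply/mem_set.
Qed.

Fact I_P (k : nat) (a : A) :
  I_ F k a <-> forall m, a@_m != 0 -> (k <= zdeg m)%N.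
Proof.
split.
  apply: (smallest_sub (supp_submod (fun m => (k <= zdeg m)%N))).
  move=> x [i /= ki]; move: x.
  apply: (smallest_sub (supp_submod (fun m => (k <= zdeg m)%N))).
  move=> _ [m /= zm <-] m'; rewrite [_@__]mcoeffU.
  by have [<- _|_] := eqVneq m m'; [rewrite zm | rewrite mulr0n eqxx].
move=> Pa; apply/set_mem; rewrite (monalgE a).
have [S0 SL] := lspan_submod (\bigcup_(i in [set i | (k <= i)%N]) A_deg F i).
rewrite big_seq; elim/big_ind: _ => // [x y Sx Sy | m].
  by rewrite -[x]scale1r; apply: SL.
move=> mS; have /Pa km : a@_m != 0 by rewrite mcoeff_neq0.
 apply/mem_set.
have -> : << a@_m *g m >> = a@_m *: monomial F m.
  by apply/malgP => m'; rewrite mcoeffZ !mcoeffU mulrnAr mulr1.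
apply: lspan_mulr; apply: sub_gen_smallest; exists (zdeg m) => //.
by apply: sub_gen_smallest; exists m.
Qed.

Fact zdegM (m1 m2 : {fmonom var}) : zdeg (mmul m1 m2) = (zdeg m1 + zdeg m2)%N.
Proof. by rewrite /zdeg fmM count_cat. Qed.

Fact mcoeffM_neq0 (a b : A) m : (a * b)@_m != 0 ->
  exists m1 m2, [/\ m = mmul m1 m2, a@_m1 != 0 & b@_m2 != 0].
Proof.
rewrite mcoeff_neq0 => /msuppM_le [m1 [m2 [h1 h2 ->]]].
by exists m1, m2; rewrite !mcoeff_neq0.
Qed.

Fact I_ideal (k : nat) : is_ideal (I_ F k).
Proof.
split.
  have [S0 SL] := lspan_submod (\bigcup_(i in [set i | (k <= i)%N]) A_deg F i).
  by split=> // x y Sx Sy; rewrite addrC -scaleN1r; apply: SL.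
move=> a u /I_P Iu; split; apply/I_P => m /mcoeffM_neq0 [m1 [m2 [-> h1 h2]]].
  by rewrite zdegM (leq_trans (Iu _ h2)) ?leq_addl.
by rewrite zdegM (leq_trans (Iu _ h1)) ?leq_addr.
Qed.

Fact T_ideal : is_ideal (T F).
Proof.
split; first split.
- by apply/mem_set => V [[[V0 _] _] _]; apply/set_mem.
- move=> x y /set_mem Tx /set_mem Ty; apply/mem_set => V VS.
  by apply/set_mem/VS.1.1.2; apply/mem_set; [apply: Tx | apply: Ty].
by move=> a u Tu; split=> V VS; have [] := VS.1.2 a u (Tu V VS).
Qed.

Fact U_ideal (p : nat) : is_ideal (U F p).
Proof.
have [[T0 TB] TM] := T_ideal; have [[I0 IB] IM] := I_ideal p.
have [[J0 JB] JM] := I_ideal p.+1.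
split; first split.
- apply/mem_set; exists 0; first by split; apply/set_mem.
  by exists 0; [apply/set_mem | rewrite addr0].
- move=> _ _ /set_mem[x [Tx Ix] [y Jy <-]] /set_mem[x' [Tx' Ix'] [y' Jy' <-]].
  apply/mem_set; exists (x - x').
    by split; apply/set_mem; [apply: TB | apply: IB]; apply/mem_set.
  exists (y - y'); first by apply/set_mem/JB; apply/mem_set.
  by rewrite opprD addrACA.
move=> a _ [x [Tx Ix] [y Jy <-]].
have [? ?] := TM a x Tx; have [? ?] := IM a x Ix; have [? ?] := JM a y Jy.
split; first by exists (a * x) => //; exists (a * y); rewrite ?mulrDr.
by exists (x * a) => //; exists (y * a); rewrite ?mulrDl.
Qed.

Fact U_proper (p : nat) : (0 < p)%N -> ~ U F p 1.
Proof.
move=> p0 [x [_ /I_P Ix] [y /I_P Iy xy1]].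
have: (1 : A)@_(mone : {fmonom var}) != 0 by rewrite mcoeff1 eqxx oner_eq0.
have zdeg1 : zdeg (mone : {fmonom var}) = 0%N by rewrite /zdeg fm1.
rewrite -xy1 mcoeffD; have [-> | /Ix] := eqVneq x@_mone 0.
  by rewrite add0r => /Iy; rewrite zdeg1.
by rewrite zdeg1 leqNgt p0.
Qed.

End IdealU.

Section AlgebraB.
Variables (F : fieldType) (p : nat) (charFp : p \in [pchar F]).

(* The argument is not used in the predicate itself; it carries p > 0, without
   which U could be improper and A / U not a (nontrivial) algebra. *)
Definition U_pred of p \in [pchar F] : {pred freeAlg F} := [in U F p].

Fact U_pred_idealr : idealr_closed (U_pred charFp).
Proof.
have [[U0 UB] UM] := U_ideal F p; split=> //.
  apply/negP => /set_mem; apply: U_proper.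
  exact/prime_gt0/(pcharf_prime charFp).
move=> a u v Uu Uv; rewrite -[v]opprK; apply: (UB).
  by apply/mem_set; have [] := UM a u (set_mem Uu).
by rewrite -sub0r; apply: (UB).
Qed.

HB.instance Definition _ :=
  isIdealr.Build (freeAlg F) (U_pred charFp) U_pred_idealr.

Fact U_pred_rmul : forall a, {in U_pred charFp, forall u, u * a \in U_pred charFp}.
Proof.
by move=> a u /set_mem Uu; apply/mem_set; have [] := (U_ideal F p).2 a u Uu.
Qed.

HB.instance Definition _ :=
  isRightMulClosed.Build (freeAlg F) (U_pred charFp) U_pred_rmul.

Definition B : algType F := algQuot (U_pred charFp).

Definition B_proj : freeAlg F -> B := @algQuot_pi F (freeAlg F) (U_pred charFp).
HB.instance Definition _ := GRing.LRMorphism.on B_proj.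

Definition B_even : set B := B_proj @` A_even F.
Definition B_odd : set B := B_proj @` A_odd F.

End AlgebraB.

Arguments B_proj {F p} charFp.
Arguments B_even {F p} charFp.
Arguments B_odd {F p} charFp.

(* Main.v *)
From HB Require Import structures.
Require Import Defs.
From mathcomp Require Import all_boot all_algebra mpoly zify.

(** The free algebra is mapped to differential forms in such a way that
    commutators become exact forms, and the polynomials in C_2(B) are tested
    through one coefficient of their image.  Because of the inverse Cartier
    operator that coefficient sees a central polynomial in 2k variables that no
    central polynomial in fewer variables can produce.

    Let Omega be the algebra of differential forms in x_0, x_1, ... over F, with
    the parameter tau = x_2k treated as a constant.  An element u of Omega whose
    odd part is the differential of its even part is called [fedosov]; such
    elements form a subalgebra, so the morphism [form_map], which sends y_i to
    x_i + dx_i for i < 2k, the first z to tau, and the other letters to 0, takes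
    its values there.  The commutator of a + da and b + db is 2 da db, which is
    central; hence every morphism from the free algebra to Omega kills T.  A graded
    endomorphism sends each z to an element of degree at least 1 in Z; followed
    by [form_map], it maps I_j into tau^j Omega.  Let [top] be the coefficient of
    tau^p (x_0 ... x_(2k-1))^(p-1) dx_0 ... dx_(2k-1).  It vanishes on exact
    forms, for no derivative with respect to x_i contains x_i^(p-1), and on
    tau^(p+1) Omega.

    The polynomials f such that, after every graded endomorphism, the image of f
    is a scalar c plus a multiple of tau^p, with zero top coefficient, form a
    T_2-subalgebra ([undetected_T2]): a product of two multiples of tau^p is
    invisible.  The polynomial z^p prod_i y_2i^(p-1) [y_2i, y_2i+1] y_2i+1^(p-1)
    is in C_2(B) ([witness_poly_C2]) and is detected ([witness_detected]).
    Conversely, if f in C_2(B) only involves letters of index less than k - 1,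
    then f is undetected ([central_undetected]).  A finite set S involves finitely
    many letters; for large k it generates only undetected polynomials, so it
    does not generate C_2(B).

    For the converse, f in C_2(B) gives g = f - c in I_p with [g, y] in
    T + I_(p+1) for a letter y that does not occur in f.  What must be shown is
    that the image of g under any such morphism has zero top coefficient
    ([top_central]).  Fix a letter v.  Replacing its image X by X + X w, where w is
    a new odd element, and using centrality, one finds that the Euler operator
    of v maps g to something with zero top coefficient ([top_euler]).  By Fermat's
    little theorem one may then discard from g all words in which v occurs a
    number of times prime to p.  When this is done for all letters, each
    remaining word has top coefficient zero by itself ([top_word_p]): writing
    a + da for the image of a letter, the word is a sum of products of p-th
    powers of the elements a and of factors a^(p-1) da, at most one such factor
    for each letter.  Modulo exact forms a^(p-1) da is additive in a and vanishes
    when a^2 = 0, so only the component of a of degree 0 matters; consequently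
    the product is, up to an exact form, homogeneous of degree at most the number
    of letters, which is less than 2k. *)

Set Implicit Arguments.
Unset Strict Implicit.
Unset Printing Implicit Defensive.

Import GRing.Theory.
Local Open Scope ring_scope.

(** * The exterior algebra over a commutative algebra *)

Section ExteriorAlgebra.
Variables (F : fieldType) (P : comAlgType F) (m : nat).
Local Notation form := {set 'I_m}.

Definition inversions (I J : form) : nat :=
  (\sum_(i in I) \sum_(j in J) (j < i))%N.

Lemma big_disjointU (I J : form) (f : 'I_m -> nat) : [disjoint I & J] ->
  (\sum_(i in I :|: J) f i = \sum_(i in I) f i + \sum_(i in J) f i)%N.
Proof.
by move=> dIJ; rewrite -bigU //; apply: eq_bigl => i; rewrite !inE.
Qed.

Lemma inversionsUl (I J K : form) : [disjoint I & J] ->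
  inversions (I :|: J) K = (inversions I K + inversions J K)%N.
Proof. by move=> dIJ; rewrite /inversions (big_disjointU _ dIJ). Qed.

Lemma inversionsUr (I J K : form) : [disjoint J & K] ->
  inversions I (J :|: K) = (inversions I J + inversions I K)%N.
Proof.
move=> dJK; rewrite /inversions -big_split; apply: eq_bigr => i _ /=.
by rewrite (big_disjointU _ dJK).
Qed.

Lemma inversions_sym (I J : form) : [disjoint I & J] ->
  (inversions I J + inversions J I = #|I| * #|J|)%N.
Proof.
move=> dIJ; rewrite /inversions [X in (_ + X)%N]exchange_big -big_split /=.
rewrite -sum1_card big_distrl /=; apply: eq_bigr => i Ii.
rewrite mul1n -sum1_card -big_split; apply: eq_bigr => j Jj /=.
have: i != j by apply: contraTneq Jj => <-; rewrite (disjointFr dIJ Ii).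
by rewrite -val_eqE /=; case: ltngtP.
Qed.

(** The structure constant of e_K in e_I e_J. *)
Definition wedge_coef (I J K : form) : P :=
  (-1) ^+ inversions I J *+ ([disjoint I & J] && (I :|: J == K)).

(** The component at I is the coefficient of the product, in increasing order,
    of the odd generators indexed by I. *)
Definition ext := {ffun form -> P}.
HB.instance Definition _ := GRing.Lmodule.on ext.

Definition ext_mul (f g : ext) : ext :=
  [ffun K => \sum_I \sum_J wedge_coef I J K * (f I * g J)].
Definition ext_scalar (q : P) : ext := [ffun K => q *+ (K == set0)].

(** Associativity reduces to this identity: both sides count the inversions of
    the pairs (I, J), (I, H) and (J, H). *)
Lemma wedge_coefA I J H K :
  \sum_A wedge_coef I J A * wedge_coef A H K =
  \sum_A wedge_coef I A K * wedge_coef J H A.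
Proof.
rewrite (bigD1 (I :|: J)) //= [X in _ + X]big1 => [|A /negPf nA]; last first.
  by rewrite /wedge_coef [_ == A]eq_sym nA andbF mul0r.
rewrite (bigD1 (J :|: H)) //= [X in _ = _ + X]big1 => [|A /negPf nA]; last first.
  by rewrite /wedge_coef [_ == A]eq_sym nA andbF mulr0.
rewrite !addr0 /wedge_coef !eqxx !andbT setUA.
have -> : [disjoint I :|: J & H] = [disjoint I & H] && [disjoint J & H].
  by rewrite -!setI_eq0 setIUl setU_eq0.
have -> : [disjoint I & J :|: H] = [disjoint I & J] && [disjoint I & H].
  by rewrite -!setI_eq0 setIUr setU_eq0.
have [dIJ|] := boolP [disjoint I & J]; last by rewrite !mul0r.
have [dIH|] := boolP [disjoint I & H]; last by rewrite mulr0 mul0r.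
have [dJH|] := boolP [disjoint J & H]; last by rewrite !mulr0.
rewrite inversionsUl // inversionsUr //=.
case: eqP => _; rewrite ?(mulr0n, mulr0, mul0r) // !mulr1n -!exprD.
by rewrite addnA.
Qed.

Fact ext_mulA : associative ext_mul.
Proof.
move=> f g h; apply/ffunP => K; rewrite !ffunE.
transitivity (\sum_I \sum_J \sum_H
    (\sum_A wedge_coef I A K * wedge_coef J H A) * (f I * (g J * h H))).
  apply: eq_bigr => I _.
  under [RHS]eq_bigr => J _ do under eq_bigr => H _ do rewrite big_distrl.
  under [RHS]eq_bigr => J _ do rewrite exchange_big.
  rewrite [RHS]exchange_big; apply: eq_bigr => A _ /=; rewrite !ffunE.
  rewrite !big_distrr; apply: eq_bigr => J _ /=.
  rewrite !big_distrr; apply: eq_bigr => H _ /=.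
  by rewrite -!mulrA; congr (_ * _); rewrite mulrCA.
under eq_bigr => I _ do under eq_bigr => J _ do under eq_bigr => H _ do
  rewrite -wedge_coefA [X in _ * X]mulrA.
under [RHS]eq_bigr => A _ do under eq_bigr => H _ do rewrite ffunE.
rewrite [RHS]exchange_big /=.
transitivity (\sum_H \sum_I \sum_J
    (\sum_A wedge_coef I J A * wedge_coef A H K) * (f I * g J * h H)).
  rewrite [RHS]exchange_big; apply: eq_bigr => I _ /=.
  by rewrite exchange_big.
apply: eq_bigr => H _ /=.
under eq_bigr => I _ do under eq_bigr => J _ do rewrite big_distrl.
under eq_bigr => I _ do rewrite exchange_big.
rewrite exchange_big; apply: eq_bigr => A _ /=.
rewrite big_distrl big_distrr; apply: eq_bigr => I _ /=.
rewrite big_distrl big_distrr; apply: eq_bigr => J _ /=.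
by rewrite mulrAC mulrC -!mulrA; congr (_ * _); rewrite mulrCA.
Qed.

Lemma ext_scalar_mul q f K : ext_mul (ext_scalar q) f K = q * f K.
Proof.
rewrite ffunE (bigD1 set0) //= [X in _ + X]big1 => [|I /negPf nI]; last first.
  by apply: big1 => J _; rewrite ffunE nI mul0r mulr0.
rewrite (bigD1 K) //= [X in _ + X + _]big1 => [|J /negPf nJ]; last first.
  by rewrite /wedge_coef set0U nJ andbF mul0r.
rewrite !addr0 ffunE eqxx /wedge_coef set0U eqxx -setI_eq0 set0I eqxx.
by rewrite /inversions big_set0 expr0 mul1r.
Qed.

Lemma ext_mul_scalar q f K : ext_mul f (ext_scalar q) K = f K * q.
Proof.
rewrite ffunE exchange_big (bigD1 set0) //= [X in _ + X]big1 => [|I /negPf nI]; last first.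
  by apply: big1 => J _; rewrite ffunE nI !mulr0.
rewrite (bigD1 K) //= [X in _ + X + _]big1 => [|J /negPf nJ]; last first.
  by rewrite /wedge_coef setU0 nJ andbF mul0r.
rewrite !addr0 ffunE eqxx /wedge_coef setU0 eqxx -setI_eq0 setI0 eqxx.
by rewrite /inversions big1 ?expr0 ?mul1r // => i _; rewrite big_set0.
Qed.

Fact ext_mul1 : left_id (ext_scalar 1) ext_mul.
Proof. by move=> f; apply/ffunP => K; rewrite ext_scalar_mul mul1r. Qed.

Fact ext_mulr1 : right_id (ext_scalar 1) ext_mul.
Proof. by move=> f; apply/ffunP => K; rewrite ext_mul_scalar mulr1. Qed.

Fact ext_mulDl : left_distributive ext_mul +%R.
Proof.
move=> f g h; apply/ffunP => K; rewrite !ffunE -big_split; apply: eq_bigr => I _.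
rewrite -big_split; apply: eq_bigr => J _ /=.
by rewrite !ffunE mulrDl mulrDr.
Qed.

Fact ext_mulDr : right_distributive ext_mul +%R.
Proof.
move=> f g h; apply/ffunP => K; rewrite !ffunE -big_split; apply: eq_bigr => I _.
rewrite -big_split; apply: eq_bigr => J _ /=.
by rewrite !ffunE !mulrDr.
Qed.

Fact ext_one_neq0 : ext_scalar 1 != 0.
Proof.
by apply/eqP => /ffunP/(_ set0)/eqP; rewrite !ffunE eqxx oner_eq0.
Qed.

HB.instance Definition _ := GRing.Zmodule_isNzRing.Build ext
  ext_mulA ext_mul1 ext_mulr1 ext_mulDl ext_mulDr ext_one_neq0.

Fact ext_scalerAl (c : F) (f g : ext) : c *: (f * g) = (c *: f) * g.
Proof.
apply/ffunP => K; rewrite !ffunE scaler_sumr; apply: eq_bigr => I _.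
rewrite scaler_sumr; apply: eq_bigr => J _.
by rewrite !ffunE -scalerAl -scalerAr.
Qed.

HB.instance Definition _ := GRing.Lmodule_isLalgebra.Build F ext ext_scalerAl.

Fact ext_scalerAr (c : F) (f g : ext) : c *: (f * g) = f * (c *: g).
Proof.
apply/ffunP => K; rewrite !ffunE scaler_sumr; apply: eq_bigr => I _.
rewrite scaler_sumr; apply: eq_bigr => J _.
by rewrite !ffunE -!scalerAr.
Qed.

HB.instance Definition _ := GRing.Lalgebra_isAlgebra.Build F ext ext_scalerAr.

Lemma ext_mulE (f g : ext) K :
  (f * g) K = \sum_I \sum_J wedge_coef I J K * (f I * g J).
Proof. by rewrite ffunE. Qed.

Lemma ext1E K : (1 : ext) K = (K == set0)%:R.
Proof. by rewrite ffunE. Qed.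

(** Even ([b = false]) and odd ([b = true]) components for the Z/2-grading. *)
Definition part (b : bool) (f : ext) : ext := [ffun K => f K *+ (odd #|K| == b)].
Local Notation ev := (part false).
Local Notation od := (part true).

Fact part_is_linear b : linear (part b).
Proof. by move=> c f g; apply/ffunP => K; rewrite !ffunE mulrnDl scalerMnr. Qed.
HB.instance Definition _ b := GRing.isLinear.Build F ext ext _ (part b) (part_is_linear b).

Lemma ev_od f : ev f + od f = f.
Proof.
by apply/ffunP => K; rewrite !ffunE; case: odd; rewrite ?addr0 ?add0r.
Qed.

Lemma part_part a b f : part a (part b f) = part b f *+ (a == b).
Proof.
apply/ffunP => K; rewrite ffunMnE !ffunE.
by case: a; case: b; case: odd; rewrite ?mul0rn.
Qed.

Lemma wedge_coef_card I J K :
  wedge_coef I J K = wedge_coef I J K *+ (#|K| == #|I| + #|J|)%N.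
Proof.
rewrite /wedge_coef; have [dIJ|] := boolP [disjoint I & J]; last by rewrite mul0rn.
have [<-|] := eqP; last by rewrite mul0rn.
by rewrite cardsU disjoint_setI0 // cards0 subn0 eqxx.
Qed.

Lemma part_mul a b c f g :
  part c (part a f * part b g) = part a f * part b g *+ (c == a (+) b).
Proof.
apply/ffunP => K; rewrite ffunMnE ffunE !ext_mulE -!sumrMnl; apply: eq_bigr => I _.
rewrite -!sumrMnl; apply: eq_bigr => J _.
rewrite wedge_coef_card !ffunE; case: eqP => [->|_]; last by rewrite !mul0r !mul0rn.
rewrite oddD; case: eqP => [->|_]; last by rewrite !(mul0r, mulr0) !mul0rn.
case: eqP => [->|_]; last by rewrite !mulr0 !mul0rn.
by rewrite eq_sym.
Qed.

Lemma evM (f g : ext) : ev (f * g) = ev f * ev g + od f * od g.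
Proof.
rewrite -{1}[f]ev_od -{1}[g]ev_od mulrDl !mulrDr !raddfD /= !part_mul /=.
by rewrite !mulr0n !mulr1n addr0 add0r.
Qed.

Lemma odM (f g : ext) : od (f * g) = ev f * od g + od f * ev g.
Proof.
rewrite -{1}[f]ev_od -{1}[g]ev_od mulrDl !mulrDr !raddfD /= !part_mul /=.
by rewrite !mulr0n !mulr1n addr0 add0r.
Qed.

Lemma wedge_coefC I J K : wedge_coef J I K = (-1) ^+ (#|I| * #|J|) * wedge_coef I J K.
Proof.
rewrite /wedge_coef disjoint_sym setUC.
have [dIJ|] := boolP [disjoint I & J]; last by rewrite mulr0.
rewrite mulrnAr; congr (_ *+ _).
by rewrite -(inversions_sym dIJ) exprD mulrAC -expr2 sqrr_sign mul1r.
Qed.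

Lemma part_comm a b f g :
  part a f * part b g = (-1) ^+ (a && b) *: (part b g * part a f).
Proof.
apply/ffunP => K; rewrite [RHS]ffunE !ext_mulE exchange_big scaler_sumr.
apply: eq_bigr => J _; rewrite scaler_sumr; apply: eq_bigr => I _ /=.
rewrite wedge_coefC !ffunE.
case: eqP => [Ia|_]; last by rewrite !mulr0n !(mul0r, mulr0) scaler0.
case: eqP => [Jb|_]; last by rewrite !mulr0n !(mul0r, mulr0) scaler0.
rewrite -signr_odd oddM Ia Jb andbC !mulr1n [f I * _]mulrC.
by case: (a && b); rewrite ?expr1 ?expr0 ?scaleN1r ?scale1r ?mul1r ?mulN1r ?mulNr.
Qed.

Lemma evC (f g : ext) : ev f * g = g * ev f.
Proof.
rewrite -[g]ev_od mulrDl mulrDr part_comm [ev f * od g]part_comm /=.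
by rewrite expr0 !scale1r.
Qed.

Lemma odC (f g : ext) : od f * od g = - (od g * od f).
Proof. by rewrite part_comm expr1 scaleN1r. Qed.

(** The grading automorphism: it records the sign paid by an odd element that
    moves past [f]. *)
Definition sigma (f : ext) := ev f - od f.

Lemma sigmaM (f g : ext) : sigma (f * g) = sigma f * sigma g.
Proof.
by rewrite /sigma evM odM mulrBl !mulrBr opprB opprD addrACA.
Qed.

Lemma od_sigma (f g : ext) : od f * g = sigma g * od f.
Proof.
by rewrite -{1}[g]ev_od mulrDr -evC odC -mulrBl.
Qed.

(** Even elements are central, so only odd parts contribute to a commutator, and
    odd elements anticommute. *)
Lemma ext_comm2 (f g : ext) : f * g - g * f = (od f * od g) *+ 2.
Proof.
rewrite -{1 2}[f]ev_od mulrDl mulrDr evC opprD addrACA subrr add0r.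
rewrite -{1 2}[g]ev_od mulrDr mulrDl -evC opprD addrACA subrr add0r.
by rewrite [od g * _]odC opprK mulr2n.
Qed.

Lemma ext_comm3 (f g h : ext) : (f * g - g * f) * h = h * (f * g - g * f).
Proof.
have evE : ev (od f * od g) = od f * od g by rewrite part_mul mulr1n.
by rewrite ext_comm2 -evE -raddfMn evC.
Qed.

Definition ext_gen (i : 'I_m) : ext := [ffun K => (K == [set i])%:R].

Lemma od_gen i : od (ext_gen i) = ext_gen i.
Proof.
apply/ffunP => K; rewrite !ffunE; case: eqP => [->|_]; last by rewrite mul0rn.
by rewrite cards1.
Qed.

Lemma gen_sigma i (f : ext) : ext_gen i * f = sigma f * ext_gen i.
Proof. by rewrite -od_gen od_sigma. Qed.

Lemma mul_gen_notin (f : ext) i (K : form) : i \notin K -> (f * ext_gen i) K = 0.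
Proof.
move=> iK; rewrite ext_mulE big1 // => I _; rewrite big1 // => J _.
rewrite ffunE; case: eqP => [->|_]; last by rewrite !mulr0.
rewrite /wedge_coef; case: eqP => [KE|_]; last by rewrite andbF mul0r.
by rewrite -KE !inE eqxx orbT in iK.
Qed.

Lemma mul_gen_in (f : ext) i (K : form) : i \in K ->
  (f * ext_gen i) K = (-1) ^+ inversions (K :\ i) [set i] * f (K :\ i).
Proof.
move=> iK; rewrite ext_mulE (bigD1 (K :\ i)) //= [X in _ + X]big1 ?addr0.
  rewrite (bigD1 [set i]) //= [X in _ + X]big1 ?addr0.
    rewrite ffunE eqxx mulr1 /wedge_coef setUC setD1K // eqxx andbT.
    by rewrite disjoint_sym disjoints1 !inE eqxx.
  by move=> J /negPf nJ; rewrite ffunE nJ !mulr0.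
move=> I nI; rewrite big1 // => J _.
rewrite ffunE; case: eqP => [->|_]; last by rewrite !mulr0.
rewrite /wedge_coef disjoint_sym disjoints1.
have [iI|iI] := boolP (i \in I); first by rewrite mul0r.
case: eqP => [KE|_]; last by rewrite mul0r.
by case/negP: nI; rewrite -KE setUC setU1K.
Qed.

Lemma gen_mul_in (f : ext) i (K : form) : i \in K ->
  exists s : bool, (ext_gen i * f) K = (-1) ^+ s * f (K :\ i).
Proof.
move=> iK; rewrite gen_sigma mul_gen_in // /sigma !ffunE.
case: odd; rewrite ?mulr1n ?mulr0n ?sub0r ?subr0 ?add0r.
  by exists (~~ odd (inversions (K :\ i) [set i])); rewrite -signr_odd signrN mulrN mulNr.
by exists (odd (inversions (K :\ i) [set i])); rewrite signr_odd.
Qed.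

Lemma gen_mul_notin (f : ext) i (K : form) : i \notin K -> (ext_gen i * f) K = 0.
Proof. by move=> iK; rewrite gen_sigma mul_gen_notin. Qed.

Lemma ext_scalarE q (f : ext) K : (ext_scalar q * f) K = q * f K.
Proof. exact: ext_scalar_mul. Qed.

End ExteriorAlgebra.

(** * Differential forms and the inverse Cartier operator *)

Section DifferentialForms.
Variables (F : fieldType) (m : nat) (D : {set 'I_m}).
Local Notation form := {set 'I_m}.
Local Notation Omega := (ext {mpoly F[m]} m).
Local Notation ev := (part false).
Local Notation od := (part true).
Hypothesis char_neq2 : (2%:R : F) != 0.

Lemma ext_double0 (x : Omega) : x *+ 2 = 0 -> x = 0.
Proof.
move/eqP; rewrite -scaler_nat scaler_eq0 (negPf char_neq2) /=.
by move/eqP.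
Qed.

Definition pderiv i (f : Omega) : Omega := [ffun K => (f K)^`M(i)].
Fact pderiv_is_linear i : linear (pderiv i).
Proof. by move=> c f g; apply/ffunP => K; rewrite !ffunE mderivD mderivZ. Qed.
HB.instance Definition _ i :=
  GRing.isLinear.Build F Omega Omega _ (pderiv i) (pderiv_is_linear i).

Lemma pderivE i (f : Omega) K : pderiv i f K = (f K)^`M(i).
Proof. by rewrite ffunE. Qed.

Lemma mderiv_wedge i (I J K : form) (q : {mpoly F[m]}) :
  (wedge_coef {mpoly F[m]} I J K * q)^`M(i) = wedge_coef _ I J K * q^`M(i).
Proof.
rewrite /wedge_coef; case: (_ && _); last by rewrite mulr0n !mul0r mderiv0.
by rewrite mulr1n -signr_odd !mulr_sign; case: odd; rewrite ?mderivN.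
Qed.

Lemma pderivM i (f g : Omega) : pderiv i (f * g) = pderiv i f * g + f * pderiv i g.
Proof.
apply/ffunP => K; rewrite [RHS]ffunE pderivE !ext_mulE raddf_sum -big_split.
apply: eq_bigr => I _; rewrite raddf_sum -big_split; apply: eq_bigr => J _ /=.
by rewrite mderiv_wedge mderivM !pderivE mulrDr.
Qed.

Lemma part_pderiv b i f : part b (pderiv i f) = pderiv i (part b f).
Proof. by apply/ffunP => K; rewrite !ffunE mderivMn. Qed.

Lemma pderiv_gen i j : pderiv i (ext_gen {mpoly F[m]} j : Omega) = 0.
Proof.
by apply/ffunP => K; rewrite !ffunE; case: eqP => _; rewrite ?mderiv0 // -mpolyC1 mderivC.
Qed.

Lemma pderiv_comm i j f : pderiv i (pderiv j f) = pderiv j (pderiv i f).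
Proof. by apply/ffunP => K; rewrite !ffunE mderiv_comm. Qed.

(** The exterior differential relative to the directions in [D]; the other
    variables are constants for it. *)
Definition exterior_d (f : Omega) : Omega := \sum_(i in D) ext_gen _ i * pderiv i f.
Local Notation d := exterior_d.

Fact d_is_linear : linear d.
Proof.
move=> c f g; rewrite /exterior_d scaler_sumr -big_split; apply: eq_bigr => i _ /=.
by rewrite linearP mulrDr scalerAr.
Qed.
HB.instance Definition _ := GRing.isLinear.Build F Omega Omega _ d d_is_linear.

Lemma part_gen_mul b i (f : Omega) : part b (ext_gen _ i * f) = ext_gen _ i * part (~~ b) f.
Proof.
have evg : ev (ext_gen {mpoly F[m]} i) = 0 by rewrite -od_gen part_part.
by case: b; rewrite ?evM ?odM evg od_gen mul0r add0r.
Qed.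

Lemma part_d b (f : Omega) : part b (d f) = d (part (~~ b) f).
Proof.
rewrite /exterior_d raddf_sum; apply: eq_bigr => i _ /=.
by rewrite part_gen_mul part_pderiv.
Qed.

Lemma dM (f g : Omega) : d (f * g) = d f * g + sigma f * d g.
Proof.
rewrite /exterior_d big_distrl big_distrr -big_split; apply: eq_bigr => i _ /=.
by rewrite pderivM mulrDr !mulrA [ext_gen _ i * f]gen_sigma.
Qed.

Lemma gen_anticomm i j :
  ext_gen {mpoly F[m]} i * ext_gen _ j = - (ext_gen _ j * ext_gen _ i) :> Omega.
Proof. by rewrite -[ext_gen _ i]od_gen -[ext_gen _ j]od_gen odC. Qed.

(** Partial derivatives commute while the generators anticommute, so the double
    sum is its own opposite. *)
Lemma d_d (f : Omega) : d (d f) = 0.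
Proof.
apply: ext_double0; rewrite mulr2n.
pose S := \sum_(i in D) \sum_(j in D) ext_gen {mpoly F[m]} i * ext_gen _ j * pderiv i (pderiv j f).
have dE : d (d f) = S.
  apply: eq_bigr => i _; rewrite raddf_sum big_distrr; apply: eq_bigr => j _ /=.
  by rewrite pderivM pderiv_gen mul0r add0r mulrA.
rewrite dE {2}/S exchange_big -big_split big1 // => i _ /=.
rewrite -big_split big1 // => j _ /=.
rewrite -[ext_gen _ j * ext_gen _ i]opprK -gen_anticomm pderiv_comm.
by rewrite mulNr subrr.
Qed.

Lemma sigma_sigma (f : Omega) : sigma (sigma f) = f.
Proof.
rewrite /sigma !raddfB /= !part_part /= !mulr0n !mulr1n subr0 oppr0 add0r opprK.
exact: ev_od.
Qed.

Lemma sigma0 : sigma (0 : Omega) = 0.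
Proof. by rewrite /sigma !raddf0 addr0. Qed.

Lemma d_sigma (f : Omega) : d (sigma f) = - sigma (d f).
Proof. by rewrite /sigma !part_d raddfB opprB. Qed.

Definition homogeneous k (u : Omega) := forall K : form, #|K| != k -> u K = 0.

Lemma homogeneousM k l (u v : Omega) :
  homogeneous k u -> homogeneous l v -> homogeneous (k + l) (u * v).
Proof.
move=> hu hv K nK; rewrite ext_mulE big1 // => I _; rewrite big1 // => J _.
have [Ik|/hu->] := eqVneq #|I| k; last by rewrite mul0r mulr0.
have [Jl|/hv->] := eqVneq #|J| l; last by rewrite !mulr0.
by rewrite wedge_coef_card Ik Jl (negPf nK) mul0r.
Qed.

(** Modulo exact forms, [x] is a closed form of degree exactly [k].  For a
    coefficient that vanishes on exact forms this means that only degree [k] is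
    visible. *)
Definition exact_upto k (x : Omega) :=
  exists eta u, [/\ x = d eta + u, d u = 0 & homogeneous k u].

(** Closed forms form a subalgebra in which exact forms are an ideal. *)
Lemma exact_uptoM k l x y :
  exact_upto k x -> exact_upto l y -> exact_upto (k + l) (x * y).
Proof.
move=> [a [u [-> du hu]]] [b [v [-> dv hv]]].
(* As d b + v is closed, d (a (d b + v)) = d a (d b + v); the sign in
   d (sigma u b) = u d b is compensated by sigma. *)
exists (a * (d b + v) + sigma u * b), (u * v); split; last exact: homogeneousM.
  rewrite raddfD /= !dM raddfD /= d_d dv addr0 mulr0 addr0.
  by rewrite d_sigma du sigma0 oppr0 mul0r add0r sigma_sigma mulrDl !mulrDr !addrA.
by rewrite dM du dv mul0r mulr0 addr0.
Qed.

Lemma exact_uptoD k x y : exact_upto k x -> exact_upto k y -> exact_upto k (x + y).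
Proof.
move=> [a [u [-> du hu]]] [b [v [-> dv hv]]].
exists (a + b), (u + v); split; first by rewrite raddfD /= addrACA.
  by rewrite raddfD /= du dv addr0.
by move=> K nK; rewrite ffunE hu ?hv ?addr0.
Qed.

Lemma exact_upto_d k x : exact_upto k (d x).
Proof. by exists x, 0; split; rewrite ?addr0 ?raddf0 // => K _; rewrite ffunE. Qed.

Lemma exact_upto1 : exact_upto 0 1.
Proof.
exists 0, 1; split; first by rewrite raddf0 add0r.
  apply: (@addIr _ (d 1)); rewrite add0r -[in RHS](mulr1 (1 : Omega)) dM mulr1.
  rewrite (_ : sigma 1 = 1) ?mul1r //; apply/ffunP => K; rewrite !ffunE.
  by case: eqP => [->|_]; rewrite ?cards0 ?mulr0n ?mulr1n ?subr0 // !mul0rn subr0.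
by move=> K; rewrite ext1E -cards_eq0 => /negPf ->.
Qed.

Lemma exact_uptoX x n : exact_upto 0 x -> exact_upto 0 (x ^+ n).
Proof.
move=> hx; elim: n => [|n IH]; first exact: exact_upto1.
by rewrite exprS; apply: (@exact_uptoM 0 0).
Qed.

Lemma sigma_even (x : Omega) : ev x = x -> sigma x = x.
Proof.
move=> ex; rewrite /sigma -{2}ex part_part mulr0n subr0; exact: ex.
Qed.

Lemma evenX (x : Omega) n : ev x = x -> ev (x ^+ n) = x ^+ n.
Proof.
move=> ex; elim: n => [|n IH].
  apply/ffunP => K; rewrite !ffunE.
  by case: eqP => [->|_]; rewrite ?cards0 ?mul0rn.
have ox : od x = 0 by rewrite -ex part_part.
by rewrite exprS evM ox mul0r addr0 ex IH.
Qed.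

Lemma d_exp (x : Omega) n : ev x = x -> d (x ^+ n.+1) = x ^+ n * d x *+ n.+1.
Proof.
move=> ex; elim: n => [|n IH]; first by rewrite expr1 expr0 mul1r mulr1n.
rewrite exprS dM IH (sigma_even ex) mulrnAr mulrA -exprS [in RHS]mulrS.
by congr (_ + _); rewrite -(evenX n.+1 ex) evC.
Qed.

Lemma sqr_od (x : Omega) : od x * od x = 0.
Proof. by apply: ext_double0; rewrite mulr2n {1}odC addNr. Qed.

Section Characteristic.
Variable p : nat.
Hypotheses (charFp : p \in [pchar F]) (p_gt2 : (2 < p)%N).

Lemma ext_pchar : p \in [pchar Omega].
Proof.
have p_pr := pcharf_prime charFp.
by rewrite inE p_pr /= -scaler_nat (pcharf0 charFp) scale0r.
Qed.

Lemma d_expp (x : Omega) : ev x = x -> d (x ^+ p) = 0.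
Proof.
move=> ex; rewrite -(prednK (prime_gt0 (pcharf_prime charFp))) d_exp //.
rewrite (prednK (prime_gt0 (pcharf_prime charFp))).
by rewrite -mulr_natr (pcharf0 ext_pchar) mulr0.
Qed.

(** The inverse Cartier operator a |-> a^(p-1) da is additive modulo exact
    forms: formally the defect is the differential of ((x + y)^p - x^p - y^p) /
    p, whose coefficients are integers. *)
Lemma inverse_CartierD (x y : Omega) : ev x = x -> ev y = y ->
  exists eta, (x + y) ^+ p.-1 * d (x + y) =
              x ^+ p.-1 * d x + y ^+ p.-1 * d y + d eta.
Proof.
move=> ex ey; have p_pr := pcharf_prime charFp.
have cxy : GRing.comm x y by rewrite /GRing.comm -ex evC.
have combine (R : nzRingType) (z u v S1 S2 a b : R) : z = u + S1 -> z = S2 + v ->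
    z * a + z * b = u * a + v * b + (S1 * a + S2 * b).
  by move=> zu zv; rewrite {1}zu zv !mulrDl [S2 * b + _]addrC addrACA.
have: prime p.-1.+1 by rewrite prednK ?prime_gt0.
move: p.-1 => q {}p_pr.
(* With p = q + 1, these are the integers binomial(p, i + 1) / p. *)
pose e i := ('C(q.+1, i.+1) %/ q.+1)%N.
have eE i : (i < q)%N -> (e i * q.+1 = 'C(q.+1, i.+1))%N.
  by move=> iq; rewrite divnK // prime_dvd_bin.
have e1 i : (i < q)%N -> (e i * i.+1 = 'C(q, i))%N.
  move=> iq; apply/eqP; rewrite -(eqn_pmul2l (ltn0Sn q)).
  by rewrite mulnA [(_ * e i)%N]mulnC eE // mulnC -mul_bin_diag.
have e2 i : (i < q)%N -> (e i * (q - i) = 'C(q, i.+1))%N.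
  move=> iq; apply/eqP; rewrite -(eqn_pmul2l (ltn0Sn q)).
  by rewrite mulnA [(_ * e i)%N]mulnC eE // mulnC -subSS -(mul_bin_down q.+1).
exists (\sum_(i < q) (x ^+ (q - i) * y ^+ i.+1) *+ e i).
have -> : d (\sum_(i < q) (x ^+ (q - i) * y ^+ i.+1) *+ e i) =
  (\sum_(i < q) (x ^+ (q - i.+1) * y ^+ i.+1) *+ 'C(q, i.+1)) * d x +
  (\sum_(i < q) (x ^+ (q - i) * y ^+ i) *+ 'C(q, i)) * d y.
  rewrite raddf_sum !big_distrl -big_split; apply: eq_bigr => i _ /=.
  rewrite raddfMn /= dM (sigma_even (evenX _ ex)) d_exp // mulrnDl.
  rewrite -(e1 i) // -(e2 i) // -(subnSK (ltn_ord i)) d_exp //.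
  rewrite !mulrnAl !mulrnAr -!mulrnA [(_ * e i)%N]mulnC [(i.+1 * e i)%N]mulnC mulrA.
  congr (_ *+ _ + _).
  by rewrite -!mulrA; congr (_ * _); rewrite -(evenX i.+1 ey) evC.
rewrite raddfD /= mulrDr.
(* The two truncations of the binomial sum omit x^q and y^q respectively. *)
have E1 : (x + y) ^+ q = x ^+ q +
    \sum_(i < q) (x ^+ (q - i.+1) * y ^+ i.+1) *+ 'C(q, i.+1).
  by rewrite exprDn_comm // big_ord_recl subn0 bin0 mulr1.
have E2 : (x + y) ^+ q =
    \sum_(i < q) (x ^+ (q - i) * y ^+ i) *+ 'C(q, i) + y ^+ q.
  by rewrite exprDn_comm // big_ord_recr /= subnn binn mul1r.
exact: combine E1 E2.
Qed.

Definition monoform (K : form) (q : {mpoly F[m]}) : Omega :=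
  [ffun J => q *+ (J == K)].

Lemma sum_monoform (f : Omega) : f = \sum_K monoform K (f K).
Proof.
apply/ffunP => J; rewrite sum_ffunE (bigD1 J) //= ffunE eqxx big1 ?addr0 // => K.
by rewrite ffunE eq_sym => /negPf ->.
Qed.

Lemma sqr_monoform (K : form) q : K != set0 -> monoform K q * monoform K q = 0.
Proof.
move=> K0; apply/ffunP => J; rewrite ext_mulE big1 ?ffunE // => I1 _.
rewrite big1 // => I2 _; rewrite !ffunE.
have [->|_] := eqVneq I1 K; last by rewrite mul0r mulr0.
have [->|_] := eqVneq I2 K; last by rewrite !mulr0.
by rewrite /wedge_coef -setI_eq0 setIid (negPf K0) mul0r.
Qed.

Lemma exact_upto0 k : exact_upto k 0.
Proof. by rewrite -[0](raddf0 d); apply: exact_upto_d. Qed.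

(** The two values a^p and a^(p-1) da of the inverse Cartier operator on an even
    element, seen modulo exact forms.  The point of bundling them is that the
    conjunction is stable under sums. *)
Definition Cartier_good (x : Omega) :=
  [/\ ev x = x, exact_upto 0 (x ^+ p) & exact_upto 1 (x ^+ p.-1 * d x)].

Lemma Cartier_goodD x y : Cartier_good x -> Cartier_good y -> Cartier_good (x + y).
Proof.
move=> [ex x0 x1] [ey y0 y1]; split; first by rewrite raddfD /= ex ey.
  have cxy : GRing.comm x y by rewrite /GRing.comm -ex evC.
  have := pFrobenius_autD_comm ext_pchar cxy; rewrite !pFrobenius_autE => ->.
  exact: exact_uptoD x0 y0.
have [eta ->] := inverse_CartierD ex ey.
by apply: exact_uptoD; [apply: exact_uptoD | apply: exact_upto_d].
Qed.

(** Here p > 2 matters: x^(p-1) vanishes together with x^2. *)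
Lemma Cartier_good_sqr0 x : ev x = x -> x * x = 0 -> Cartier_good x.
Proof.
move=> ex xx; split=> //.
  by case: p p_gt2 => [|[|q]] // _; rewrite !exprS mulrA xx mul0r; apply: exact_upto0.
case: p p_gt2 => [|[|[|q]]] // _ /=.
by rewrite !exprS mulrA xx !mul0r; apply: exact_upto0.
Qed.

Lemma homogeneous_d k (u : Omega) : homogeneous k u -> homogeneous k.+1 (d u).
Proof.
move=> hu K nK; rewrite sum_ffunE big1 // => i _.
have [iK|iK] := boolP (i \in K); last by rewrite gen_mul_notin.
have [s ->] := gen_mul_in (pderiv i u) iK.
rewrite pderivE hu ?mderiv0 ?mulr0 //.
by move: nK; rewrite (cardsD1 i K) iK.
Qed.

Lemma homogeneous0X (u : Omega) n : homogeneous 0 u -> homogeneous 0 (u ^+ n).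
Proof.
move=> hu; elim: n => [|n IH]; last by rewrite exprS; apply: (@homogeneousM 0 0).
by move=> K; rewrite ext1E -cards_eq0 => /negPf ->.
Qed.

Lemma Cartier_good_scalar x : homogeneous 0 x -> Cartier_good x.
Proof.
move=> hx; have ex : ev x = x.
  apply/ffunP => K; rewrite ffunE; have [->//|/hx->] := eqVneq #|K| 0%N.
  by rewrite mul0rn.
split=> //.
  exists 0, (x ^+ p); split; first by rewrite raddf0 add0r.
    exact: d_expp.
  exact: homogeneous0X.
exists 0, (x ^+ p.-1 * d x); split; first by rewrite raddf0 add0r.
  rewrite dM d_d mulr0 addr0; case: p p_gt2 => [|[|q]] //= _.
  have odx : od (d x) = d x by rewrite part_d /= ex.
  by rewrite d_exp // mulrnAl -mulrA -odx sqr_od mulr0 mul0rn.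
apply: (@homogeneousM 0 1); first exact: homogeneous0X.
exact: homogeneous_d.
Qed.

(** An even form is the sum of its function part, for which the claim is clear,
    and of monomials of positive degree, which square to zero. *)
Lemma even_Cartier_good x : ev x = x -> Cartier_good x.
Proof.
move=> ex; rewrite (sum_monoform x); apply: (big_ind Cartier_good).
- by apply: Cartier_good_scalar => K _; rewrite ffunE.
- exact: Cartier_goodD.
move=> K _; have [->|K0] := eqVneq K set0.
  apply: Cartier_good_scalar => J; rewrite ffunE -cards_eq0 => /negPf ->.
  by rewrite mulr0n.
apply: Cartier_good_sqr0; last exact: sqr_monoform.
apply/ffunP => J; rewrite !ffunE; have [->|] := eqVneq J K; last by rewrite mul0rn.
by rewrite mulr1n -{2}ex ffunE.
Qed.

End Characteristic.
End DifferentialForms.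

(** * The top coefficient of a product of odd perturbations *)

Section ExtScalars.
Variables (F : fieldType) (P : comAlgType F) (m : nat).
Implicit Types (q r : P).

Lemma ext_scalarM q r :
  ext_scalar m (q * r) = ext_scalar m q * ext_scalar m r :> ext P m.
Proof. by apply/ffunP => K; rewrite ext_scalarE !ffunE mulrnAr. Qed.

Lemma ext_scalarX q n : ext_scalar m (q ^+ n) = ext_scalar m q ^+ n :> ext P m.
Proof. by elim: n => [|n IH] //; rewrite !exprS ext_scalarM IH. Qed.

Lemma ext_scalarC q (x : ext P m) : ext_scalar m q * x = x * ext_scalar m q.
Proof. by apply/ffunP => K; rewrite ext_scalarE [RHS]ext_mul_scalar mulrC. Qed.

End ExtScalars.

Section TopCoefficient.
Variables (F : fieldType) (m : nat) (D : {set 'I_m}).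
Local Notation form := {set 'I_m}.
Local Notation Omega := (ext {mpoly F[m]} m).
Local Notation ev := (part false).
Local Notation od := (part true).
Local Notation d := (@exterior_d F m D).
Variables (p : nat) (charFp : p \in [pchar F]) (p_gt2 : (2 < p)%N).
Variable mon : 'X_{1..m}.
Hypothesis mon_top : forall i, i \in D -> (p %| (mon i).+1)%N.
Hypothesis D_even : ~~ odd #|D|.

Lemma char_neq2 : (2%:R : F) != 0.
Proof. by rewrite -(dvdn_pcharf charFp) gtnNdvd. Qed.
#[local] Hint Resolve char_neq2 : core.

Definition coef_at (K : form) (x : Omega) : F := (x K)@_mon.
Fact coef_at_is_linear K : linear_for *%R (coef_at K).
Proof. by move=> c x y; rewrite /coef_at !ffunE mcoeffD mcoeffZ. Qed.
HB.instance Definition _ K :=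
  GRing.isLinear.Build F Omega F *%R (coef_at K) (coef_at_is_linear K).

(** The coefficient of x^mon times the volume form in the directions [D]; by
    hypothesis the exponents of [mon] in these directions are -1 modulo p. *)
Definition top := coef_at D.
HB.instance Definition _ := GRing.Linear.on top.

(** A derivative with respect to x_i has no monomial whose exponent in x_i is -1
    modulo p. *)
Lemma top_d x : top (d x) = 0.
Proof.
rewrite /top raddf_sum big1 // => i iD; rewrite /= /coef_at.
have [s ->] := gen_mul_in (pderiv i x) iD.
rewrite pderivE mulr_sign.
have e0 : ((x (D :\ i))^`M(i))@_mon = 0.
  rewrite mcoeff_deriv; have /dvdnP[c ->] := mon_top iD.
  by rewrite mulnC mulrnA -[_ *+ p]mulr_natr (pcharf0 charFp) mulr0 mul0rn.
by case: s; rewrite ?mcoeffN e0 ?oppr0.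
Qed.

Lemma top1 : (0 < #|D|)%N -> top 1 = 0.
Proof.
by rewrite lt0n cards_eq0 /top /coef_at ext1E => /negPf ->; rewrite mcoeff0.
Qed.

Lemma top_od x : top (od x) = 0.
Proof. by rewrite /top /coef_at ffunE (negPf D_even) mulr0n mcoeff0. Qed.

Lemma top_ev x : top (ev x) = top x.
Proof. by rewrite -{2}[x]ev_od raddfD /= top_od addr0. Qed.

Lemma top_exact_upto k x : exact_upto D k x -> k != #|D| -> top x = 0.
Proof.
move=> [a [u [-> _ hu]]] kD; rewrite raddfD /= top_d add0r.
by rewrite /top /coef_at hu ?mcoeff0 // eq_sym.
Qed.

Lemma coef_at_Xn K (t : 'I_m) k (u : Omega) : (mon t < k)%N ->
  coef_at K (ext_scalar _ ('X_t ^+ k) * u) = 0.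
Proof.
move=> tk; rewrite /coef_at ext_scalarE mcoeffM big1 // => -[k1 k2] /= /eqP mE.
rewrite mcoeffXn; case: eqP => [e|_]; last by rewrite mul0r.
have : (k <= mon t)%N by rewrite {1}mE -e mnmDE mulmnE mnm1E eqxx mul1n leq_addr.
by rewrite leqNgt tk.
Qed.

Definition poly_form (t : 'I_m) : Omega := ext_scalar _ 'X_t.

Lemma poly_formC t (x : Omega) : poly_form t * x = x * poly_form t.
Proof. exact: ext_scalarC. Qed.

Lemma coef_at_poly_form K (t : 'I_m) k (u : Omega) : (mon t < k)%N ->
  coef_at K (poly_form t ^+ k * u) = 0.
Proof. by move=> tk; rewrite -ext_scalarX coef_at_Xn. Qed.

(** Two auxiliary generators outside [D] serve as formal parameters: the
    coefficient of their product can be tested on [top]. *)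
Lemma coef_at_gen2 (x : Omega) a b : a \notin D -> b \notin D -> a != b ->
  coef_at (b |: (a |: D)) (x * ext_gen _ a * ext_gen _ b) = 0 -> top x = 0.
Proof.
move=> aD bD ab; rewrite /top /coef_at mul_gen_in ?setU11 //.
rewrite setU1K ?inE ?negb_or ?bD ?andbT 1?eq_sym //.
rewrite mul_gen_in ?setU11 // setU1K //.
rewrite -signr_odd mulr_sign -[X in X * _]signr_odd mulr_sign.
by case: odd; case: odd; rewrite ?opprK ?mcoeffN => /eqP; rewrite ?oppr_eq0 => /eqP.
Qed.

(** The multiplicative form of the Fedosov product: a |-> a + da is an
    isomorphism from the even forms with the product ab + da db onto these
    elements. *)
Definition fedosov (x : Omega) := od x = d (ev x).

Lemma fedosovM x y : fedosov x -> fedosov y -> fedosov (x * y).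
Proof.
rewrite /fedosov => hx hy; rewrite odM evM raddfD /= !dM hx hy !(dM, d_d) //.
rewrite mul0r mulr0 addr0 addr0 addrC; congr (_ + _).
by rewrite sigma_even // part_part.
Qed.

Lemma fedosovD x y : fedosov x -> fedosov y -> fedosov (x + y).
Proof. by rewrite /fedosov !raddfD /= => -> ->. Qed.

Lemma fedosovZ c x : fedosov x -> fedosov (c *: x).
Proof. by rewrite /fedosov !linearZ /= => ->. Qed.

Lemma part1 b : part b (1 : Omega) = 1 *+ ~~ b.
Proof.
apply/ffunP => K; rewrite ffunMnE !ffunE.
by have [->|_] := eqVneq K set0; rewrite ?cards0 ?mul0rn //; case: b.
Qed.

Lemma fedosov1 : fedosov 1.
Proof.
rewrite /fedosov !part1 mulr0n mulr1n.
by have := d_expp D charFp (part1 false); rewrite expr1n => ->.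
Qed.

(** The difference of the two sides is twice the top coefficient of x (od y),
    whose even part is the product of two exact forms, hence exact. *)
Lemma top_sigma x y : fedosov x -> fedosov y -> top (x * sigma y) = top (x * y).
Proof.
move=> hx hy; rewrite -{2}[y]ev_od /sigma mulrBr mulrDr raddfB raddfD /=.
suff -> : top (x * od y) = 0 by rewrite subr0 addr0.
rewrite -{1}[x]ev_od mulrDl raddfD /= -(top_ev (ev x * _)) part_mul /=.
rewrite mulr0n raddf0 add0r hx hy.
have -> : d (ev x) * d (ev y) = d (ev x * d (ev y)).
  by rewrite dM d_d // mulr0 addr0.
exact: top_d.
Qed.

Section Words.
Variables (V : eqType) (h : V -> Omega).
Hypothesis h_fedosov : forall v, fedosov (h v).

Lemma fedosov_prod s : fedosov (\prod_(v <- s) h v).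
Proof. by apply: big_ind; [exact: fedosov1 | exact: fedosovM |]. Qed.

(** First-order expansion of a word in which the letter [i] is perturbed by an
    odd element [w].  Moving [w] to the right end twists what follows by
    [sigma], which [top] does not see; each occurrence of [i] then contributes
    the same amount. *)
Lemma perturbed_word (w : Omega) i s : od w = w ->
  exists K, \prod_(v <- s) (h v + (h v * w) *+ (v == i)) = \prod_(v <- s) h v + K * w /\
    forall x y, fedosov x -> fedosov y ->
      top (x * K * sigma y) = top (x * \prod_(v <- s) h v * y) *+ count_mem i s.
Proof.
move=> ow; have ws u : w * u = sigma u * w by rewrite -ow od_sigma.
have ww : w * w = 0 by rewrite -ow sqr_od.
elim: s => [|v s [K [E IH]]].
  exists 0; rewrite !big_nil mul0r addr0; split=> // x y _ _.
  by rewrite mulr0 mul0r raddf0.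
set H := \prod_(v <- s) h v in E IH *.
exists (h v * K + (h v * sigma H) *+ (v == i)); split.
  rewrite !big_cons -/H E mulrDl mulrDr -addrA mulrDl -mulrA; congr (_ + (_ + _)).
  have wK : w * (K * w) = 0 by rewrite mulrA ws -mulrA ww mulr0.
  by rewrite mulrDr !mulrnAl -!mulrA wK mulr0 mul0rn addr0 ws.
move=> x y hx hy; rewrite big_cons -/H [x * (_ + _)]mulrDr mulrDl raddfD /= mulrA.
have hxv : fedosov (x * h v) by exact: fedosovM.
have hHy : fedosov (H * y) by apply: fedosovM => //; exact: fedosov_prod.
have E1 : x * (h v * sigma H) * sigma y = x * h v * sigma (H * y).
  by rewrite sigmaM !mulrA.
have E2 : x * (h v * H) * y = x * h v * (H * y) by rewrite !mulrA.
rewrite (IH _ _ hxv hy) mulrnAr mulrnAl raddfMn /= E1 (top_sigma hxv hHy) E2 -mulrA.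
by rewrite -mulrnDr addnC.
Qed.

Local Notation a v := (ev (h v)).
Local Notation b v := (od (h v)).

Lemma prod_bump (vs : seq V) (e : V -> nat) v k : uniq vs -> v \in vs ->
  \prod_(u <- vs) a u ^+ (e u + k * (u == v)) = a v ^+ k * \prod_(u <- vs) a u ^+ e u.
Proof.
elim: vs => // u vs IH /= /andP[uvs uniq_vs]; rewrite inE !big_cons.
have evX n w : ev (a w ^+ n) = a w ^+ n by apply: evenX; rewrite part_part.
have [-> _|_ /= vvs] := eqVneq v u; last first.
  have swap (R : nzRingType) (x y z : R) : x * y = y * x -> x * (y * z) = y * (x * z).
    by move=> xy; rewrite mulrA xy mulrA.
  rewrite muln0 addn0 (IH uniq_vs vvs); apply: swap; rewrite -evX; exact: evC.
rewrite muln1 addnC exprD -mulrA; congr (_ * (_ * _)).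
apply: eq_big_seq => w wvs; have [wu|_] := eqVneq w u; last by rewrite muln0 addn0.
by rewrite -wu wvs in uvs.
Qed.

Lemma prod_od0 (l : seq V) v : v \in l -> (\prod_(u <- l) b u) * b v = 0.
Proof.
elim: l => // u l IH; rewrite inE big_cons => /predU1P[->|/IH]; last first.
  by rewrite -mulrA => ->; rewrite mulr0.
rewrite -mulrA; suff [c ->] : exists c, (\prod_(w <- l) b w) * b u = b u * c.
  by rewrite mulrA (sqr_od char_neq2) mul0r.
elim: l {IH} => [|w l [c E]]; first by exists 1; rewrite big_nil mul1r mulr1.
by exists (- (b w * c)); rewrite big_cons -mulrA E mulrA odC mulNr mulrN mulrA.
Qed.

(** To prove an additive property of a word in the elements a + da it suffices
    to consider the monomials a^e times a product of distinct da's, with the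
    same content as the word. The predicate [W] stands for any condition that is
    stable under sums. *)
Lemma word_monomials (W : Omega -> Prop) (vs s : seq V) :
    uniq vs -> {subset s <= vs} ->
    W 0 -> (forall x y, W x -> W y -> W (x + y)) ->
    (forall e l, uniq l -> {subset l <= vs} ->
      (forall v, v \in vs -> e v + (v \in l) = count_mem v s)%N ->
      W (\prod_(v <- vs) a v ^+ e v * \prod_(v <- l) b v)) ->
  W (\prod_(v <- s) h v).
Proof.
move=> uvs; elim/last_ind: s W => [|s v IH] W svs W0 WD Wmon.
  rewrite big_nil.
  have := Wmon (fun=> 0%N) [::] isT; rewrite big_nil mulr1 big1 //; apply=> //.
rewrite -cats1 big_cat big_seq1 /=.
have vvs : v \in vs by apply: svs; rewrite mem_rcons mem_head.
apply: (IH (fun x => W (x * h v))) => [u us||x y|e l ul lvs eE].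
- by apply: svs; rewrite mem_rcons inE us orbT.
- by rewrite mul0r.
- by rewrite mulrDl; apply: WD.
rewrite -[h v]ev_od mulrDr; apply: WD.
  rewrite -evC mulrA -(expr1 (a v)) -prod_bump //.
  apply: Wmon => // u uu; rewrite mul1n addnAC eE // -cats1 count_cat /= addn0.
  by rewrite eq_sym.
rewrite -mulrA; have [vl|vl] := boolP (v \in l); first by rewrite prod_od0 ?mulr0.
have -> : (\prod_(u <- l) b u) * b v = \prod_(u <- rcons l v) b u.
  by rewrite -cats1 big_cat big_seq1.
apply: Wmon; rewrite ?rcons_uniq ?vl //.
  by move=> u; rewrite mem_rcons inE => /predU1P[->|/lvs].
move=> u uu; rewrite mem_rcons inE -cats1 count_cat /= addn0 -(eE u uu) -addnA.
congr (_ + _)%N; have [->|_] := eqVneq u v; first by rewrite (negPf vl).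
by rewrite addn0.
Qed.

(** When all contents are divisible by p, the monomial is a product of p-th
    powers and of as many factors a^(p-1) da as there are differentials. *)
Lemma exact_upto_monomial (vs l : seq V) (e : V -> nat) :
    uniq vs -> uniq l -> {subset l <= vs} ->
    (forall v, v \in vs -> p %| e v + (v \in l))%N ->
  exact_upto D (size l) (\prod_(v <- vs) a v ^+ e v * \prod_(v <- l) b v).
Proof.
move=> uvs; elim: l e => [|v l IH] e /=.
  move=> _ _ pe; rewrite big_nil mulr1 big_seq.
  apply: (big_ind (exact_upto D 0)); [exact: exact_upto1 | exact: (@exact_uptoM _ _ _ _ 0 0) |].
  move=> v /pe; rewrite addn0 => /dvdnP[q ->]; rewrite mulnC exprM.
  apply: exact_uptoX => //.
  by have [] := @even_Cartier_good _ _ D char_neq2 p charFp p_gt2 (a v) _; rewrite ?part_part.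
move=> /andP[vl ul] lvs pe; have vvs : v \in vs by apply: lvs; rewrite mem_head.
have p_gt0 : (0 < p)%N by apply: leq_trans p_gt2.
have ev_ge : (p.-1 <= e v)%N.
  have := pe v vvs; rewrite mem_head addn1 => pe1.
  by rewrite -ltnS prednK //; apply: dvdn_leq pe1.
(* The exponent of v is -1 modulo p, so that a factor a^(p-1) can be split
   off to accompany the differential of v. *)
pose e' u := (e u - p.-1 * (u == v))%N.
have -> : \prod_(u <- vs) a u ^+ e u = a v ^+ p.-1 * \prod_(u <- vs) a u ^+ e' u.
  rewrite -prod_bump //; apply: eq_bigr => u _; congr (_ ^+ _); rewrite /e' subnK //.
  by have [->|_] := eqVneq u v; rewrite ?muln1 ?muln0.
rewrite big_cons -mulrA [X in _ * X]mulrA.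
have -> : (\prod_(u <- vs) a u ^+ e' u) * b v = b v * \prod_(u <- vs) a u ^+ e' u.
  have -> : \prod_(u <- vs) a u ^+ e' u = ev (\prod_(u <- vs) a u ^+ e' u).
    apply: (big_ind (fun x => x = ev x)); first by rewrite part1.
      by move=> x y -> ->; rewrite part_mul.
    by move=> u _; rewrite evenX ?part_part.
  exact: evC.
rewrite -mulrA mulrA; apply: (@exact_uptoM _ _ _ _ 1) => //.
  rewrite h_fedosov.
  by have [] := @even_Cartier_good _ _ D char_neq2 p charFp p_gt2 (a v) _; rewrite ?part_part.
apply: IH => // [u ul'|u uu]; first by apply: lvs; rewrite inE ul' orbT.
have := pe u uu; rewrite inE /e'; have [->|_] := eqVneq u v; last by rewrite muln0 subn0.
rewrite (negPf vl) addn0 muln1 => pe1; rewrite -(dvdn_addl _ (dvdnn p)).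
by rewrite -[X in (_ + X)%N](prednK p_gt0) addnS subnK // -addn1.
Qed.

(** There are fewer distinct letters, hence fewer differentials, than directions
    in [D]; so the degree is too small for [top]. *)
Lemma top_word_p s : (size (undup s) < #|D|)%N ->
  (forall v, p %| count_mem v s)%N -> top (\prod_(v <- s) h v) = 0.
Proof.
move=> sD ps; apply: (@word_monomials (fun x => top x = 0) (undup s)).
- exact: undup_uniq.
- by move=> v; rewrite mem_undup.
- exact: raddf0.
- by move=> x y hx hy; rewrite raddfD /= hx hy addr0.
move=> e l ul lvs eE; apply: (@top_exact_upto (size l)).
  by apply: exact_upto_monomial => // [|v vs]; rewrite ?undup_uniq ?eE.
by rewrite neq_ltn (leq_ltn_trans (uniq_leq_size ul lvs)).
Qed.

End Words.
End TopCoefficient.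

(** * Rings in which all triple commutators vanish *)

(** The polynomial x^(p-1) [x, y] y^(p-1) represents the class of the inverse
    Cartier operator on dx dy. *)
Definition block (p : nat) (S : nzRingType) (x y : S) : S :=
  x ^+ p.-1 * (x * y - y * x) * y ^+ p.-1.

Definition witness (p : nat) (S : nzRingType) k (z : S) (y : nat -> S) : S :=
  z ^+ p * \prod_(i < k) block p (y i.*2) (y i.*2.+1).

Section LieNilpotent.
Variable R : nzRingType.
Hypothesis comm3R : forall x y z : R, (x * y - y * x) * z = z * (x * y - y * x).
Variable (p : nat).

Lemma rmorph_witness (S1 S2 : nzRingType) (h : {rmorphism S1 -> S2}) k z y :
  h (witness p k z y) = witness p k (h z) (h \o y).
Proof.
rewrite rmorphM rmorphXn rmorph_prod; congr (_ * _); apply: eq_bigr => i _ /=.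
by rewrite /block !rmorphM rmorphB !rmorphM !rmorphXn.
Qed.

Lemma commutator_exp (x z : R) k :
  x ^+ k.+1 * z - z * x ^+ k.+1 = x ^+ k * (x * z - z * x) *+ k.+1.
Proof.
elim: k => [|k IH]; first by rewrite !expr1 expr0 mul1r.
have -> : x ^+ k.+2 * z - z * x ^+ k.+2 =
    x * (x ^+ k.+1 * z - z * x ^+ k.+1) + (x * z - z * x) * x ^+ k.+1.
  by rewrite [x ^+ k.+2]exprS mulrBr mulrBl !mulrA addrA subrK.
by rewrite IH comm3R mulrnAr mulrA -exprS [RHS]mulrSr.
Qed.

(** The commutator [x, xz] = x [x, z] commutes with y. *)
Lemma commutatorMr (x y z : R) : (x * y - y * x) * (x * z - z * x) = 0.
Proof.
have E : x * (x * z - z * x) = x * (x * z) - x * z * x by rewrite mulrBr [x * (z * x)]mulrA.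
have := comm3R x (x * z) y; rewrite -E => h.
by rewrite mulrBl -!mulrA -h -(comm3R x z y) [x * (_ * y)]mulrA subrr.
Qed.

Hypotheses (charRp : p \in [pchar R]) (p_gt2 : (2 < p)%N).

Lemma central_expp (x z : R) : x ^+ p * z = z * x ^+ p.
Proof.
apply/eqP; rewrite -subr_eq0; have p_gt0 := prime_gt0 (pcharf_prime charRp).
by rewrite -(prednK p_gt0) commutator_exp (prednK p_gt0) -mulr_natr (pcharf0 charRp) mulr0.
Qed.

(** Commuting z past a power of x or y produces a factor [x, z] or [y, z], which
    the factor [x, y] annihilates. *)
Lemma central_block (x y z : R) : block p x y * z = z * block p x y.
Proof.
rewrite /block; have -> : p.-1 = p.-2.+1 by move: p_gt2; case: (p) => [|[|]].
set q := p.-2; set c := x * y - y * x.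
have cC u : c * u = u * c by exact: comm3R.
have cx : c * (x * z - z * x) = 0 by exact: commutatorMr.
have cy : c * (y * z - z * y) = 0.
  by rewrite -[c]opprK opprB mulNr commutatorMr oppr0.
apply/eqP; rewrite -subr_eq0 -cC -!mulrA [z * _]mulrA -cC -!mulrA -mulrBr.
have -> : x ^+ q.+1 * (y ^+ q.+1 * z) - z * (x ^+ q.+1 * y ^+ q.+1) =
    x ^+ q.+1 * (y ^+ q.+1 * z - z * y ^+ q.+1) +
    (x ^+ q.+1 * z - z * x ^+ q.+1) * y ^+ q.+1.
  by rewrite mulrBr mulrBl !mulrA addrA subrK.
rewrite !commutator_exp mulrDr !mulrnAr !mulrnAl !mulrnAr.
rewrite !mulrA cC -[x ^+ _ * c * _]mulrA cC -!mulrA cy !mulr0 mul0rn add0r.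
by rewrite [c * _]mulrA cC -!mulrA [c * _]mulrA cx mul0r mulr0 mul0rn.
Qed.

Lemma central_witness k z y (u : R) : witness p k z y * u = u * witness p k z y.
Proof.
rewrite /witness -mulrA; set q := \prod_(i < k) _.
have -> : q * u = u * q.
  rewrite /q; elim/big_ind: _ => [|a b ha hb|i _]; first by rewrite mulr1 mul1r.
    by rewrite -mulrA hb !mulrA ha.
  exact: central_block.
by rewrite mulrA central_expp mulrA.
Qed.

End LieNilpotent.

(** * A polynomial detected by the top coefficient *)

Section Generators.
Variables (F : fieldType) (m : nat) (D : {set 'I_m}).
Local Notation Omega := (ext {mpoly F[m]} m).
Local Notation ev := (part false).
Local Notation od := (part true).
Local Notation x_ i := (poly_form F i : Omega).
Local Notation e_ i := (ext_gen {mpoly F[m]} i : Omega).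

Lemma part_poly_form b i : part b (x_ i) = x_ i *+ ~~ b.
Proof.
apply/ffunP => K; rewrite ffunMnE !ffunE.
by have [->|_] := eqVneq K set0; rewrite ?cards0 ?mulr0n ?mul0rn //; case: b.
Qed.

Lemma d_poly_form i : exterior_d D (x_ i) = e_ i *+ (i \in D).
Proof.
have pE j : pderiv j (x_ i) = (i == j)%:R.
  apply/ffunP => K; rewrite pderivE [poly_form F i K]ffunE ffunMnE ext1E mderivMn.
  rewrite mderivX mnm1E; have [->|_] := eqVneq i j; last by rewrite scale0r mul0rn mulr0n.
  rewrite scale1r (_ : (U_(j) - U_(j))%MM = 0%MM) ?mpolyX0 //.
  by apply/mnmP => u; rewrite mnmBE mnm0E subnn.
rewrite /exterior_d; have [iD|iD] := boolP (i \in D).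
  rewrite (bigD1 i) //= pE eqxx mulr1 big1 ?addr0 // => j /andP[_ ji].
  by rewrite pE eq_sym (negPf ji) mulr0.
rewrite big1 // => j jD; rewrite pE; case: eqP => [E|_]; last by rewrite mulr0.
by rewrite E jD in iD.
Qed.

Lemma fedosov_even_letter i : i \in D -> fedosov D (x_ i + e_ i).
Proof.
move=> iD; have evg : ev (e_ i) = 0 by rewrite -od_gen part_part.
rewrite /fedosov [od _]raddfD [ev _]raddfD /= !part_poly_form od_gen evg.
by rewrite mulr0n mulr1n add0r addr0 d_poly_form iD.
Qed.

Lemma fedosov_odd_letter i : i \notin D -> fedosov D (x_ i).
Proof. by move=> iD; rewrite /fedosov !part_poly_form d_poly_form (negPf iD). Qed.

End Generators.

Section TopOfWitness.
Variables (F : fieldType) (p k : nat).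
Hypotheses (charFp : p \in [pchar F]) (p_gt2 : (2 < p)%N).
Local Notation m := k.*2.+2.
Local Notation Omega := (ext {mpoly F[m]} m).
Local Notation idx i := (inord i : 'I_m).
Local Notation x_ i := (poly_form F (idx i) : Omega).
Local Notation e_ i := (ext_gen {mpoly F[m]} (idx i) : Omega).

Definition dirs : {set 'I_m} := [set i : 'I_m | (i < k.*2)%N].

(** The exponents are p at the parameter tau and p - 1 in each of the 2k
    directions of differentiation. *)
Definition top_mon : 'X_{1..m} :=
  (U_(idx k.*2) *+ p +
   \sum_(i < k) (U_(idx i.*2) *+ p.-1 + U_(idx i.*2.+1) *+ p.-1))%MM.

Lemma card_dirs : #|dirs| = k.*2.
Proof.
have lekm : (k.*2 <= m)%N by rewrite -addn2 leq_addr.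
have inj : injective (widen_ord lekm) by move=> i j /(congr1 val) /= ij; apply/val_inj.
have -> : dirs = [set widen_ord lekm i | i in 'I_k.*2].
  apply/setP => i; rewrite inE; apply/idP/imsetP => [ik|[j _ ->]]; last exact: ltn_ord j.
  by exists (Ordinal ik) => //; apply/val_inj.
by rewrite card_imset // card_ord.
Qed.

Lemma idx_eq i j : (i < m)%N -> (j < m)%N -> (idx i == idx j) = (i == j).
Proof. by move=> im jm; rewrite -val_eqE /= !inordK. Qed.

Lemma ltn_double_m (i : 'I_k) : (i.*2.+1 < k.*2)%N.
Proof. by rewrite ltn_Sdouble. Qed.

Lemma top_monE j : (j < m)%N ->
  top_mon (idx j) = if (j < k.*2)%N then p.-1 else ((j == k.*2) * p)%N.
Proof.
move=> jm; rewrite mnmDE mulmnE mnm1E idx_eq ?ltnS ?leqnSn // mnm_sumE.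
have summand (i : 'I_k) : (U_(idx i.*2) *+ p.-1 + U_(idx i.*2.+1) *+ p.-1)%MM (idx j) =
    ((i == j./2 :> nat) * p.-1)%N.
  have ik := ltn_double_m i; have ik' := ltnW ik.
  rewrite mnmDE !mulmnE !mnm1E !idx_eq ?(ltn_trans ik) ?(ltn_trans ik') ?ltnS ?leqnSn //.
  rewrite -mulnDl -{1 2}[j]odd_double_half; congr (_ * _)%N.
  by case: (odd j); rewrite ?add0n ?add1n ?eqSS -?muln2; lia.
under eq_bigr => i _ do rewrite summand.
have [jk|kj] := ltnP j k.*2.
  have jk2 : (j./2 < k)%N by move: jk; lia.
  rewrite (bigD1 (Ordinal jk2)) //= eqxx mul1n big1 ?addn0; last first.
    by move=> i; rewrite -val_eqE /= => /negPf ->.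
  by rewrite eq_sym (ltn_eqF jk).
rewrite big1 ?addn0 1?eq_sym // => i _; case: eqP => // E.
by have := ltn_double_m i; rewrite E; lia.
Qed.

(** The extra factor e_i kills every further differential e_i. *)
Lemma expr_gen i n : (x_ i + e_ i) ^+ n * e_ i = x_ i ^+ n * e_ i.
Proof.
have ee : e_ i * e_ i = 0 by rewrite -od_gen sqr_od // (char_neq2 charFp p_gt2).
elim: n => [//|n IH]; rewrite !exprSr -!mulrA mulrDl ee addr0.
by rewrite poly_formC !mulrA IH.
Qed.

Lemma gen_expr i n : e_ i * (x_ i + e_ i) ^+ n = e_ i * x_ i ^+ n.
Proof.
have ee : e_ i * e_ i = 0 by rewrite -od_gen sqr_od // (char_neq2 charFp p_gt2).
have ex : e_ i * x_ i = x_ i * e_ i := esym (poly_formC _ _).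
elim: n => [//|n IH]; rewrite !exprS [LHS]mulrA mulrDr ee addr0 ex.
by rewrite -[LHS]mulrA IH [LHS]mulrA -ex -[LHS]mulrA.
Qed.

Lemma poly_formXC i n (u : Omega) : x_ i ^+ n * u = u * x_ i ^+ n.
Proof. by rewrite -ext_scalarX ext_scalarC. Qed.

Lemma block_letters i j :
  block p (x_ i + e_ i) (x_ j + e_ j) = (x_ i ^+ p.-1 * x_ j ^+ p.-1) * (e_ i * e_ j) *+ 2.
Proof.
have odE u : part true (x_ u + e_ u) = e_ u.
  by rewrite raddfD /= part_poly_form od_gen add0r.
rewrite /block ext_comm2 !odE mulrnAr mulrnAl; congr (_ *+ _).
rewrite [X in X * _]mulrA expr_gen -[LHS]mulrA gen_expr -!mulrA; congr (_ * _).
by rewrite poly_formXC -[RHS]mulrA.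
Qed.

Definition letters_mon j : {mpoly F[m]} :=
  \prod_(i < j) ('X_(idx i.*2) ^+ p.-1 * 'X_(idx i.*2.+1) ^+ p.-1).

Lemma prod_block j :
  \prod_(i < j) block p (x_ i.*2 + e_ i.*2) (x_ i.*2.+1 + e_ i.*2.+1) =
  ext_scalar m (letters_mon j) * \prod_(i < j) (e_ i.*2 * e_ i.*2.+1) *+ 2 ^ j.
Proof.
have swap (R : nzRingType) (u v c e : R) a b : c * v = v * c ->
    (u * v *+ a) * (c * e *+ b) = u * c * (v * e) *+ (a * b).
  move=> cv; rewrite mulrnAl mulrnAr -mulrnA mulnC.
  by rewrite -!mulrA [v * (c * e)]mulrA -cv -!mulrA.
have central (R : nzRingType) (u v w : R) :
    u * w = w * u -> v * w = w * v -> u * v * w = w * (u * v).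
  by move=> uw vw; rewrite -mulrA vw mulrA uw mulrA.
elim: j => [|j IH]; first by rewrite !big_ord0 /letters_mon big_ord0 mulr1.
have -> : letters_mon j.+1 =
    letters_mon j * ('X_(idx j.*2) ^+ p.-1 * 'X_(idx j.*2.+1) ^+ p.-1).
  by rewrite /letters_mon big_ord_recr.
rewrite [LHS]big_ord_recr [in RHS]big_ord_recr IH /= block_letters.
rewrite expnSr ext_scalarM [ext_scalar m ('X_(idx j.*2) ^+ _ * _)]ext_scalarM !ext_scalarX.
apply: swap.
exact: central (poly_formXC _ _ _) (poly_formXC _ _ _).
Qed.

Lemma prod_gen j : (j <= k)%N -> exists n,
  (\prod_(i < j) (e_ i.*2 * e_ i.*2.+1)) [set i : 'I_m | (i < j.*2)%N] = (-1) ^+ n.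
Proof.
elim: j => [_|j IH jk].
  have -> : [set i : 'I_m | (i < 0.*2)%N] = set0 by apply/setP => i; rewrite !inE.
  by exists 0%N; rewrite big_ord0 ext1E eqxx.
have [n E] := IH (ltnW jk); rewrite big_ord_recr /= mulrA.
have j1 : (j.*2.+1 < m)%N by lia.
have j0 : (j.*2 < m)%N by lia.
have in1 : idx j.*2.+1 \in [set i : 'I_m | (i < j.+1.*2)%N].
  by rewrite inE inordK // doubleS.
have in0 : idx j.*2 \in [set i : 'I_m | (i < j.+1.*2)%N] :\ idx j.*2.+1.
  by rewrite !inE idx_eq // inordK // doubleS; lia.
rewrite (mul_gen_in _ in1) (mul_gen_in _ in0).
rewrite (_ : _ :\ _ :\ _ = [set i : 'I_m | (i < j.*2)%N]).
  by rewrite E -!exprD; eexists.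
apply/setP => i; rewrite !inE -!val_eqE /= !inordK //.
by lia.
Qed.

Lemma mpolyX_top_mon : 'X_[top_mon] = 'X_(idx k.*2) ^+ p * letters_mon k :> {mpoly F[m]}.
Proof.
rewrite /top_mon mpolyXD mpolyXn; congr (_ * _).
rewrite (big_morph (fun u => 'X_[u] : {mpoly F[m]}) (@mpolyXD _ _) (mpolyX0 _ _)).
by apply: eq_bigr => i _; rewrite mpolyXD !mpolyXn.
Qed.

(** The image is, up to a power of 2 and a sign, the single monomial tested by
    [top]. *)
Lemma top_witness_neq0 :
  top dirs top_mon (witness p k (x_ k.*2) (fun i => x_ i + e_ i)) != 0.
Proof.
rewrite /witness prod_block mulrnAr raddfMn /= mulrA -ext_scalarX -ext_scalarM.
rewrite -mpolyX_top_mon /top /coef_at ext_scalarE.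
have [n ->] := prod_gen (leqnn k).
rewrite -signr_odd mulrC mulr_sign -mulr_natr mulf_eq0 negb_or; apply/andP; split.
  by case: odd; rewrite ?mcoeffN ?oppr_eq0 mcoeffX eqxx oner_eq0.
by rewrite natrX expf_eq0 (negPf (char_neq2 charFp p_gt2)) andbF.
Qed.

End TopOfWitness.

(** * The free algebra and its morphisms *)

From mathcomp Require Import finmap boolp classical_sets cardinality monalg.

Local Open Scope classical_set_scope.

(* From here on, coefficients of words rather than of commutative monomials. *)
Local Notation "f @_ w" := (monalg.mcoeff w f) : ring_scope.

Section Commutators.
Variables (R S : nzRingType).
Implicit Types (a b c : R).

(** [comm2] in an arbitrary ring; the identities below are applied to the free
    algebra by conversion. *)
Definition commutator a b := a * b - b * a.

Lemma rmorph_commutator (h : {rmorphism R -> S}) a b :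
  h (commutator a b) = h a * h b - h b * h a.
Proof. by rewrite /commutator rmorphB !rmorphM. Qed.

Lemma rmorph_commutator3E (h : {rmorphism R -> S}) a b c :
  h (commutator (commutator a b) c) =
  (h a * h b - h b * h a) * h c - h c * (h a * h b - h b * h a).
Proof. by rewrite !rmorph_commutator. Qed.

Lemma rmorph_commutator3 (h : {rmorphism R -> S}) a b c :
  (forall x y z : S, (x * y - y * x) * z = z * (x * y - y * x)) ->
  h (commutator (commutator a b) c) = 0.
Proof. by move=> c3; rewrite rmorph_commutator3E c3 subrr. Qed.

Lemma rmorph_kernel (h : {rmorphism R -> S}) a u :
  h u = 0 -> h (a * u) = 0 /\ h (u * a) = 0.
Proof. by move=> hu; rewrite !rmorphM hu mulr0 mul0r. Qed.

Variable der : R -> R.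
Hypotheses (derD : {morph der : a b / a + b}) (derN : {morph der : a / - a}).
Hypothesis derM : forall a b, der (a * b) = der a * b + a * der b.

Lemma der_commutator a b :
  der (commutator a b) = commutator (der a) b + commutator a (der b).
Proof.
rewrite /commutator derD derN !derM opprD [- (der b * a) + _]addrC.
exact: addrACA.
Qed.

Lemma commutatorDl a b c : commutator (a + b) c = commutator a c + commutator b c.
Proof. by rewrite /commutator mulrDl mulrDr opprD addrACA. Qed.

Lemma commutatorBl a b c : commutator (a - b) c = commutator a c - commutator b c.
Proof.
rewrite /commutator mulrBl mulrBr !opprB [c * b - _]addrC addrACA.
by rewrite [- _ + _]addrC.
Qed.

Lemma der_commutator3 a b c :
  der (commutator (commutator a b) c) =
  commutator (commutator (der a) b) c + commutator (commutator a (der b)) c +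
  commutator (commutator a b) (der c).
Proof. by rewrite !der_commutator commutatorDl. Qed.

End Commutators.

Section ZmodClosed.
Variables (V : zmodType) (S : set V).
Hypothesis zS : GRing.zmod_closed (fun x => x \in S).

Lemma zmod_set0 : S 0.
Proof. exact/set_mem/zS.1. Qed.

Lemma zmod_setB x y : S x -> S y -> S (x - y).
Proof. by move=> Sx Sy; apply/set_mem/zS.2; apply/mem_set. Qed.

Lemma zmod_setD x y : S x -> S y -> S (x + y).
Proof.
move=> Sx Sy; rewrite -[y]opprK -(sub0r (- y)) sub0r.
by apply: zmod_setB => //; rewrite -sub0r; apply: zmod_setB => //; exact: zmod_set0.
Qed.

End ZmodClosed.

Section WeightedMalg.
Variables (K : monomType) (R : nzRingType).
Implicit Types (f g : {malg R[K]}).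

Lemma malg_basisZ (c : R) w : << c *g w >> = c *: << 1 *g w >> :> {malg R[K]}.
Proof. by apply/malgP => w'; rewrite mcoeffZ !mcoeffU mulrnAr mulr1. Qed.

Lemma malg_basis f : f = \sum_(w <- msupp f) f@_w *: << 1 *g w >>.
Proof.
by rewrite {1}(monalgE f); apply: eq_bigr => w _; exact: malg_basisZ.
Qed.

Lemma mcoeff_mulU f k w : (forall w', mmul w' k = mmul w k -> w' = w) ->
  (f * << 1 *g k >>)@_(mmul w k) = f@_w.
Proof.
move=> wK; rewrite malgM_def fgmulgU raddf_sum /=.
have term w' : << f@_w' * 1 *g mmul w' k >>@_(mmul w k) = f@_w' *+ (w' == w).
  rewrite mcoeffU mulr1; have [->|ne] := eqVneq w' w; first by rewrite eqxx.
  by case: eqP => [/wK E|//]; rewrite E eqxx in ne.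
under eq_bigr => w' _ do rewrite term.
have [ws|ws] := boolP (w \in msupp f).
  rewrite (big_fsetD1 w) //= eqxx mulr1n big1_fset ?addr0 //.
  by move=> w' /[!inE] /andP[/negPf -> _] _.
rewrite (mcoeff_outdom ws) big1_fset // => w' w's _; case: eqP => [E|//].
by rewrite E (negPf ws) in w's.
Qed.

Variable wt : K -> nat.

(** When the weight is additive this is a derivation of the monoid algebra. *)
Definition weighted f : {malg R[K]} :=
  \sum_(w <- msupp f) << f@_w *+ wt w *g w >>.

Lemma mcoeff_weighted f w : (weighted f)@_w = f@_w *+ wt w.
Proof.
rewrite /weighted raddf_sum /=; have [ws|ws] := boolP (w \in msupp f).
  rewrite (big_fsetD1 w) //= mcoeffU eqxx mulr1n big1_fset ?addr0 //.
  by move=> w' /[!inE] /andP[/negPf nw _] _; rewrite mcoeffU nw.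
rewrite (mcoeff_outdom ws) mul0rn big1_fset // => w' w's _.
rewrite mcoeffU; case: eqP => [E|//].
by rewrite E (negPf ws) in w's.
Qed.

Lemma msupp_weighted f : (msupp (weighted f) `<=` msupp f)%fset.
Proof.
apply/fsubsetP => w; rewrite -!mcoeff_neq0 mcoeff_weighted.
by apply: contraNneq => ->; rewrite mul0rn.
Qed.

Lemma weighted0 : weighted 0 = 0.
Proof. by apply/malgP => w; rewrite mcoeff_weighted mcoeff0 mul0rn. Qed.

Lemma weightedD f g : weighted (f + g) = weighted f + weighted g.
Proof. by apply/malgP => w; rewrite !(mcoeff_weighted, mcoeffD) mulrnDl. Qed.

Lemma weightedN f : weighted (- f) = - weighted f.
Proof. by apply/malgP => w; rewrite !(mcoeff_weighted, mcoeffN) mulNrn. Qed.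

Hypothesis wtM : forall w1 w2, wt (mmul w1 w2) = (wt w1 + wt w2)%N.

Lemma weightedM f g : weighted (f * g) = weighted f * g + f * weighted g.
Proof.
apply/malgP => w; rewrite mcoeff_weighted mcoeffD.
rewrite (mcoeffMlw w (fsubset_refl _) (fsubset_refl _)).
rewrite (mcoeffMlw w (msupp_weighted f) (fsubset_refl _)).
rewrite (mcoeffMlw w (fsubset_refl _) (msupp_weighted g)).
rewrite -big_split -sumrMnl; apply: eq_bigr => w1 _.
rewrite -big_split -sumrMnl; apply: eq_bigr => w2 _ /=.
rewrite !mcoeff_weighted mulrnAl mulrnAr; have [<-|_] := eqVneq (mmul w1 w2) w.
  by rewrite wtM mulrnDr !mulr1n.
by rewrite !mulr0n mul0rn addr0.
Qed.

End WeightedMalg.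

Section FreeAlgebra.
Variable F : fieldType.
Local Notation A := (freeAlg F).

Definition letter (v : var) : A := monomial F (FMonom [:: v]).

Lemma monomial_prod w : monomial F w = \prod_(v <- (w : seq var)) letter v.
Proof.
have monoM w1 w2 : monomial F (mmul w1 w2) = monomial F w1 * monomial F w2.
  by rewrite malgM_def fgmulUU mulr1.
case: w => s; elim: s => [|v s IH]; rewrite ?big_nil ?big_cons.
  by congr (mkmalgU _ _); apply/val_inj; rewrite /= fm1.
by rewrite -IH -monoM; congr (monomial F _); apply/val_inj; rewrite /= fmM.
Qed.

Lemma malg_monomials (f : A) : f = \sum_(w <- msupp f) f@_w *: monomial F w.
Proof.
exact: malg_basis.
Qed.

Section Evaluation.
Variables (G : algType F) (g g' : nat -> G).

Fact eval_word_mmorphism : mmorphism (eval_word g g').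
Proof.
split=> [w1 w2|]; first by rewrite /eval_word fmM big_cat.
by rewrite /eval_word fm1 big_nil.
Qed.
HB.instance Definition _ := isMultiplicative.Build _ _ (eval_word g g') eval_word_mmorphism.

Fact evaluate_is_linear : linear (evaluate g g').
Proof.
move=> c a b; rewrite /evaluate raddfD /= mmapZ /=.
by rewrite mulr_algl.
Qed.

Fact evaluate_is_monoid_morphism : GRing.monoid_morphism (evaluate g g').
Proof.
have [hM h1] : multiplicative (evaluate g g').
  apply: commr_mmap_is_multiplicative => a m m'.
  by rewrite /GRing.comm /= mulr_algl mulr_algr.
by split.
Qed.

HB.instance Definition _ := GRing.isLinear.Build F A G _ (evaluate g g') evaluate_is_linear.
HB.instance Definition _ :=
  GRing.isMonoidMorphism.Build A G (evaluate g g') evaluate_is_monoid_morphism.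
End Evaluation.

Definition free_hom (G : algType F) (psi : var -> G) : {lrmorphism A -> G} :=
  evaluate (fun i => psi (inl i)) (fun j => psi (inr j)).

Lemma free_hom_letter (G : algType F) (psi : var -> G) v : free_hom psi (letter v) = psi v.
Proof.
rewrite /free_hom /= /evaluate mmapU /= scale1r mul1r /eval_word /= big_seq1.
by case: v.
Qed.

Section Morphisms.
Variables (G : algType F).
Implicit Types (h k : {lrmorphism A -> G}).

Lemma hom_monomial h w : h (monomial F w) = \prod_(v <- (w : seq var)) h (letter v).
Proof. by rewrite monomial_prod rmorph_prod. Qed.

Lemma homE h (f : A) :
  h f = \sum_(w <- msupp f) f@_w *: \prod_(v <- (w : seq var)) h (letter v).
Proof.
rewrite {1}(malg_monomials f) raddf_sum; apply: eq_bigr => w _ /=.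
by rewrite linearZ /= hom_monomial.
Qed.

Lemma eq_hom_on h k (f : A) :
  (forall (w : {fmonom var}) v, f@_w != 0 -> v \in (w : seq var) -> h (letter v) = k (letter v)) ->
  h f = k f.
Proof.
move=> hk; rewrite !homE big_seq [RHS]big_seq; apply: eq_bigr => w.
rewrite -mcoeff_neq0 => fw; congr (_ *: _); apply: eq_big_seq => v vw.
exact: hk vw.
Qed.

(** Stated for an arbitrary target without triple commutators, so that it
    applies both to differential forms and to commutative algebras. *)
Lemma hom_T h f : (forall x y z : G, (x * y - y * x) * z = z * (x * y - y * x)) ->
  T F f -> h f = 0.
Proof.
move=> comm3G; apply: (smallest_sub (X := [set f | h f = 0])); last first.
  move=> _ [a [b [c ->]]] /=.
  exact: rmorph_commutator3.
split.
  split=> [|x y]; first by apply/mem_set; exact: raddf0.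
  by move=> /set_mem hx /set_mem hy; apply/mem_set; rewrite /= raddfB /= hx hy subrr.
by move=> a u hu; apply: rmorph_kernel.
Qed.

Lemma hom_I h (c : G) n f : (forall x, c * x = x * c) ->
  (forall j, exists u, h (letter (inr j)) = c * u) ->
  I_ F n f -> exists u, h f = c ^+ n * u.
Proof.
move=> cC hz /I_P fn.
have hw (s : seq var) : exists u, \prod_(v <- s) h (letter v) = c ^+ count is_odd_var s * u.
  elim: s => [|v s [u E]]; first by exists 1; rewrite big_nil mulr1.
  rewrite big_cons E; case: v => [i|j] /=.
    exists (h (letter (inl i)) * u); rewrite add0n !mulrA; congr (_ * _).
    by elim: count => [|q IH]; rewrite ?mulr1 ?mul1r // exprS mulrA -cC -!mulrA IH.
  have [x ->] := hz j; exists (x * u); rewrite add1n exprS -!mulrA; congr (_ * _).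
  rewrite !mulrA; congr (_ * _).
  by elim: count => [|q IH]; rewrite ?mulr1 ?mul1r // exprS mulrA -cC -!mulrA IH.
rewrite homE big_seq; elim/big_ind: _ => [|x y [u ->] [v ->]|w].
- by exists 0; rewrite mulr0.
- by exists (u + v); rewrite mulrDr.
rewrite -mcoeff_neq0 => /fn nw; have [u] := hw w; rewrite -/(zdeg w) => ->.
exists (f@_w *: (c ^+ (zdeg w - n) * u)).
by rewrite -scalerAr mulrA -exprD subnKC.
Qed.

End Morphisms.

Section Euler.
Variable v : var.

Definition euler : A -> A := weighted (fun w : {fmonom var} => count_mem v w).

Lemma mcoeff_euler (f : A) w : (euler f)@_w = f@_w *+ count_mem v w.
Proof. exact: mcoeff_weighted. Qed.

Lemma euler0 : euler 0 = 0. Proof. exact: weighted0. Qed.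

Lemma eulerD (f g : A) : euler (f + g) = euler f + euler g.
Proof. exact: weightedD. Qed.

Lemma eulerN (f : A) : euler (- f) = - euler f.
Proof. exact: weightedN. Qed.

Lemma eulerM (f g : A) : euler (f * g) = euler f * g + f * euler g.
Proof. by apply: weightedM => w1 w2; rewrite fmM count_cat. Qed.

Lemma T_comm3 (a b c : A) : T F (comm3 a b c).
Proof. by apply: sub_gen_smallest; exists a, b, c. Qed.

(** T is stable under every derivation, since a derivation maps a triple
    commutator to a sum of three triple commutators. *)
Lemma euler_T f : T F f -> T F (euler f).
Proof.
have [zT TM] := T_ideal F.
suff : T F `<=` [set x | T F x /\ T F (euler x)] by move=> + Tf => /(_ f Tf) [].
apply: smallest_sub; last first.
  move=> _ [a [b [c ->]]]; split; first exact: T_comm3.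
  have -> : euler (comm3 a b c) =
      comm3 (euler a) b c + comm3 a (euler b) c + comm3 a b (euler c).
    exact: (der_commutator3 eulerD eulerN eulerM).
  apply: (zmod_setD zT); last exact: T_comm3.
  by apply: (zmod_setD zT); exact: T_comm3.
split.
  split; first apply/mem_set.
    split; first exact: zmod_set0 zT.
    by rewrite euler0; exact: zmod_set0 zT.
  move=> x y /set_mem[Tx Tx'] /set_mem[Ty Ty']; apply/mem_set; split.
    exact: (zmod_setB zT Tx Ty).
  by rewrite eulerD eulerN; exact: (zmod_setB zT Tx' Ty').
move=> a u [Tu Tu'].
have [au ua] := TM a u Tu; have [au' ua'] := TM a _ Tu'.
have [eau uea] := TM (euler a) u Tu.
split; [split; [exact: au|] | split; [exact: ua|]]; rewrite eulerM.
  exact: (zmod_setD zT eau au').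
exact: (zmod_setD zT ua' uea).
Qed.

Lemma euler_I k f : I_ F k f -> I_ F k (euler f).
Proof.
move=> /I_P fk; apply/I_P => w; rewrite mcoeff_euler => nz; apply: fk.
by apply: contraNneq nz => ->; rewrite mul0rn.
Qed.

End Euler.

(** In the commutator with a letter that does not occur in [f], the words w v
    and v w do not cancel unless w is empty. *)
Lemma commuting_I n (f : A) v : (forall w : {fmonom var}, f@_w != 0 -> v \notin (w : seq var)) ->
  ~~ is_odd_var v -> I_ F n (comm2 f (letter v)) -> I_ F n (f - f@_mone *: 1).
Proof.
move=> fv v_even /I_P cn; apply/I_P => w.
have [->|w1] := eqVneq w mone.
  by rewrite mcoeffB mcoeffZ mcoeff1 eqxx mulr1 subrr eqxx.
rewrite mcoeffB mcoeffZ mcoeff1 (negPf w1) mulr0 subr0 => fw.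
have vw := fv w fw.
have -> : zdeg w = zdeg (mmul w (FMonom [:: v])).
  by rewrite zdegM /= [zdeg (FMonom _)]/= /zdeg /= (negPf v_even) !addn0.
apply: cn; rewrite /comm2 mcoeffB.
have wK (w' : {fmonom var}) : mmul w' (FMonom [:: v]) = mmul w (FMonom [:: v]) -> w' = w.
  move=> /(congr1 (fun u : {fmonom var} => u : seq var)).
  by rewrite !fmM !cats1 => /rcons_inj[/val_inj].
have fL : (f * letter v)@_(mmul w (FMonom [:: v])) = f@_w.
  by rewrite /letter /monomial; exact: (mcoeff_mulU f wK).
have Lf : (letter v * f)@_(mmul w (FMonom [:: v])) = 0.
  apply/eqP/negPn/negP => /mcoeffM_neq0[w2 [w3 [E h2 _]]].
  have Ew2 : w2 = FMonom [:: v].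
    move: h2; rewrite [_@__]mcoeffU.
    by have [<-//|_] := eqVneq (FMonom [:: v]) w2; rewrite mulr0n eqxx.
  move: E => /(congr1 (fun u : {fmonom var} => u : seq var)); rewrite Ew2 !fmM /=.
  case ws: (w : seq var) vw => [|u s].
    by move=> _ _; case/eqP: w1; apply/val_inj; rewrite /= ws fm1.
  by rewrite inE negb_or => /andP[/eqP vu _] [/esym].
by rewrite [X in X - _]fL [X in _ - X]Lf subr0.
Qed.
End FreeAlgebra.

(** * Polynomials central modulo T have no top coefficient *)

Section CentralPolynomials.
Variables (F : fieldType) (p m : nat) (charFp : p \in [pchar F]) (p_gt2 : (2 < p)%N).
Variables (D : {set 'I_m}) (mon : mpoly.multinom m) (t a b : 'I_m).
Hypothesis mon_top : forall i, i \in D -> (p %| (mon i).+1)%N.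
Hypothesis mon_t : mon t = p.
Hypothesis D_even : ~~ odd #|D|.
Hypotheses (aD : a \notin D) (bD : b \notin D) (ab : a != b).
Local Notation A := (freeAlg F).
Local Notation Omega := (ext (mpoly.mpoly m F) m).
Local Notation top := (top D mon).
Local Notation ev := (part false).
Local Notation od := (part true).
Local Notation tau := (poly_form F t : Omega).

(** What centrality in B says about a polynomial in I_p.  The intersection of T
    with I_p is replaced by T, for which stability under derivations is simpler.
    *)
Definition almost_central (y g : A) :=
  exists u w, [/\ T F u, I_ F p.+1 w & comm2 g y = u + w].

Lemma hom_almost_central (h : {lrmorphism A -> Omega}) y g hg hy :
  h g = hg -> h y = hy ->
  (forall j, exists u, h (letter F (inr j)) = tau * u) ->
  almost_central y g -> exists u, hg * hy - hy * hg = tau ^+ p.+1 * u.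
Proof.
move=> <- <- hz [u [w [Tu Iw E]]].
have [x hx] := hom_I (poly_formC t) hz Iw; exists x.
rewrite -rmorph_commutator -[commutator g y]/(comm2 g y) E raddfD /= hx.
by rewrite (hom_T h (@ext_comm3 _ _ _) Tu) add0r.
Qed.

Variable h : {lrmorphism A -> Omega}.
Hypothesis h_fedosov : forall v, fedosov D (h (letter F v)).
Hypothesis h_tau : forall j, exists u, h (letter F (inr j)) = tau * u.

Local Notation hw w := (\prod_(v <- (w : seq var)) h (letter F v)).

Lemma hom_euler v (g : A) :
  h (euler v g) = \sum_(w <- msupp g) (g@_w *+ count_mem v w) *: hw w.
Proof.
have -> : euler v g = \sum_(w <- msupp g) (g@_w *+ count_mem v w) *: monomial F w.
  by apply: eq_bigr => w _; exact: malg_basisZ.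
by rewrite raddf_sum; apply: eq_bigr => w _; rewrite /= linearZ /= hom_monomial.
Qed.

(** Let [om] and [om'] be two odd parameters, and give the fresh letter the
    value [om'].  Perturbing the image of the letter [i] by [om] changes the
    image of g to h g + K om; by centrality the commutator of K om and [om'],
    which is 2 (ev K) om om', is divisible by tau^(p+1).  Thus K has no top
    coefficient, and by [perturbed_word] this is the one of the Euler
    derivative. *)
Lemma top_euler i y (g : A) :
  (forall w : {fmonom var}, g@_w != 0 -> inl y \notin (w : seq var)) ->
  almost_central (letter F (inl y)) g -> top (h (euler i g)) = 0.
Proof.
move=> gy acg; pose om : Omega := ext_gen _ a; pose om' : Omega := ext_gen _ b.
pose psi0 v := if v == inl y then om' else h (letter F v).
pose psi1 v := if v == inl y then om' else
  h (letter F v) + (h (letter F v) * om) *+ (v == i).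
have k0g : free_hom psi0 g = h g.
  apply: eq_hom_on => w v gw vw; rewrite free_hom_letter /psi0.
  by case: eqP => [E|//]; move: (gy w gw); rewrite -E vw.
have [K [k1g topK]] : exists K, free_hom psi1 g = h g + K * om /\ top K = top (h (euler i g)).
  rewrite hom_euler [free_hom psi1 g]homE [h g]homE.
  have : forall w, w \in (msupp g : seq {fmonom var}) -> inl y \notin (w : seq var).
    by move=> w; rewrite -mcoeff_neq0; exact: gy.
  elim: (msupp g : seq {fmonom var}) => [|w r IH] ry.
    by exists 0; rewrite !big_nil mul0r addr0 raddf0.
  have [w' w'r|K [E topK]] := IH; first by apply: ry; rewrite inE w'r orbT.
  have [Kw [Ew topKw]] := perturbed_word charFp p_gt2 mon_top D_even h_fedosov i (w : seq var) (od_gen _ a).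
  exists (g@_w *: Kw + K); rewrite !big_cons E; split.
    rewrite mulrDl addrACA -scalerAl -scalerDr; congr (_ *: _ + _).
    rewrite -Ew; apply: eq_big_seq => v vw; rewrite free_hom_letter /psi1.
    by case: eqP => [vy|//]; move: (ry w (mem_head _ _)); rewrite -vy vw.
  rewrite !raddfD /= topK; congr (_ + _).
  have := topKw 1 1 (fedosov1 D charFp) (fedosov1 D charFp).
  rewrite sigma_even ?part1 // !mul1r !mulr1 linearZ /= => ->; rewrite linearZ /=.
  by rewrite mulrnAr mulrnAl.
have psi1_tau j : exists u, free_hom psi1 (letter F (inr j)) = tau * u.
  rewrite free_hom_letter /psi1 /=; have [u ->] := h_tau j.
  by exists (u + (u * om) *+ (inr j == i)); rewrite mulrDr mulrnAr mulrA.
have psi0_tau j : exists u, free_hom psi0 (letter F (inr j)) = tau * u.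
  by rewrite free_hom_letter /psi0 /=; exact: h_tau.
have psi1y : free_hom psi1 (letter F (inl y)) = om' by rewrite free_hom_letter /psi1 eqxx.
have psi0y : free_hom psi0 (letter F (inl y)) = om' by rewrite free_hom_letter /psi0 eqxx.
(* Subtracting the unperturbed relation isolates the term containing om. *)
have [u1 E1] := hom_almost_central k1g psi1y psi1_tau acg.
have [u0 E0] := hom_almost_central k0g psi0y psi0_tau acg.
have E : commutator (K * om) om' = tau ^+ p.+1 * (u1 - u0).
  by rewrite mulrBr -E1 -E0 -/(commutator _ _) -/(commutator (h g) _) commutatorDl addrC addKr.
rewrite -topK -(top_ev mon D_even); apply: (coef_at_gen2 aD bD ab).
have ompart c : part c om = om *+ c by rewrite /om -od_gen part_part; case: c.
have om'od : od om' = om' by exact: od_gen.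
have {E} E : (ev K * om * om') *+ 2 = tau ^+ p.+1 * (u1 - u0).
  have odK : od (K * om) = ev K * om.
    by rewrite odM !ompart mulr0n mulr1n mulr0 addr0.
  by rewrite -E -odK -{1}om'od; exact: esym (ext_comm2 _ _).
have: coef_at mon (b |: (a |: D)) ((ev K * om * om') *+ 2) = 0.
  by rewrite E coef_at_poly_form // mon_t.
rewrite raddfMn /= -mulr_natr => /eqP.
by rewrite mulf_eq0 (negPf (char_neq2 charFp p_gt2)) orbF => /eqP.
Qed.

Lemma almost_centralB y g g' : almost_central y g -> almost_central y g' ->
  almost_central y (g - g').
Proof.
move=> [u [w [Tu Iw E]]] [u' [w' [Tu' Iw' E']]]; exists (u - u'), (w - w'); split.
- exact: (zmod_setB (T_ideal F).1 Tu Tu').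
- exact: (zmod_setB (I_ideal F _).1 Iw Iw').
have -> : comm2 (g - g') y = comm2 g y - comm2 g' y by exact: commutatorBl.
by rewrite E E' opprD addrACA.
Qed.

Lemma almost_central_euler i y g : i != y ->
  almost_central (letter F y) g -> almost_central (letter F y) (euler i g).
Proof.
move=> iy [u [w [Tu Iw E]]]; exists (euler i u), (euler i w); split.
- exact: euler_T.
- exact: euler_I.
rewrite -eulerD -E.
have -> : euler i (comm2 g (letter F y)) =
    comm2 (euler i g) (letter F y) + comm2 g (euler i (letter F y)).
  exact: (der_commutator (eulerD i) (eulerN i) (eulerM i)).
have -> : euler i (letter F y) = 0.
  apply/malgP => w'; rewrite mcoeff_euler [_@__]mcoeffU mcoeff0.
  have [<-|_] := eqVneq (FMonom [:: y]) w'; last by rewrite mul0rn.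
  by rewrite /= eq_sym (negPf iy).
by rewrite /comm2 mulr0 mul0r subr0 addr0.
Qed.

(** The letters of [vs] are treated one after the other: words in which a given
    letter occurs a number of times prime to p are removed by means of its Euler
    operator, without changing the top coefficient.  The words that remain are
    covered by [top_word_p]. *)
Lemma top_central y (vs : seq var) (g : A) :
  uniq vs -> (size vs < #|D|)%N -> inl y \notin vs ->
  (forall w : {fmonom var}, g@_w != 0 -> {subset (w : seq var) <= vs}) ->
  almost_central (letter F (inl y)) g -> top (h g) = 0.
Proof.
move=> uvs svs yvs.
suff main (ls : seq var) : {subset ls <= vs} -> forall g : A,
    (forall w : {fmonom var}, g@_w != 0 -> {subset (w : seq var) <= vs} /\
      forall v, v \in vs -> v \notin ls -> (p %| count_mem v w)%N) ->
    almost_central (letter F (inl y)) g -> top (h g) = 0.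
  move=> gvs; apply: (main vs) => // w /gvs wvs; split=> // v -> //.
elim: ls => [_|v ls IH lsv] {}g gw acg.
  rewrite homE raddf_sum big_seq big1 // => w; rewrite -mcoeff_neq0 => /gw[wvs wp].
  rewrite /= linearZ /= (top_word_p charFp p_gt2 mon_top h_fedosov) ?mulr0 //.
    apply: leq_ltn_trans svs; apply: uniq_leq_size; first exact: undup_uniq.
    by move=> v; rewrite mem_undup; exact: wvs.
  move=> v; have [vvs|/negP vvs] := boolP (v \in vs); first exact: wp.
  by rewrite (count_memPn _) //; apply/negP => /wvs.
have vvs : v \in vs by apply: lsv; rewrite mem_head.
have vy : v != inl y by apply: contraNneq yvs => <-.
have coefX n w : (iter n (euler v) g)@_w = g@_w *+ count_mem v w ^ n.
  by elim: n => [|n IHn]; rewrite ?mulr1n // iterS mcoeff_euler IHn -mulrnA expnSr.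
have acX n : almost_central (letter F (inl y)) (iter n (euler v) g).
  by elim: n => [|n IHn]; [exact: acg | exact: (almost_central_euler vy IHn)].
have gX n w : (iter n (euler v) g)@_w != 0 -> g@_w != 0.
  by rewrite coefX; apply: contraNneq => ->; rewrite mul0rn.
have topX : top (h (iter p.-1 (euler v) g)) = 0.
  have -> : p.-1 = p.-2.+1 by case: p p_gt2 => [|[|]].
  apply: (@top_euler v y (iter p.-2 (euler v) g)); last exact: acX.
  by move=> w /gX/gw[wvs _]; apply: contra yvs; exact: wvs.
have -> : top (h g) = top (h (g - iter p.-1 (euler v) g)).
  by rewrite !raddfB /= topX subr0.
have lsv' : {subset ls <= vs} by move=> u ul; apply: lsv; rewrite inE ul orbT.
refine (IH lsv' _ _ (almost_centralB acg (acX p.-1))).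
move=> w; rewrite mcoeffB coefX => nz.
have gw0 : g@_w != 0 by apply: contraNneq nz => ->; rewrite mul0rn subr0.
have [wvs wp] := gw w gw0; split=> // u uvs' uls.
have [->|uv] := eqVneq u v; last by apply: wp; rewrite // inE negb_or uv.
(* If the number of occurrences is invertible in F, its power p - 1 is 1 and
   the coefficient of the word cancels. *)
rewrite (dvdn_pcharf charFp); apply: contraNT nz => c0.
rewrite -[X in X - _]mulr1 -mulr_natr -mulrBr mulf_eq0 (negPf gw0) /=.
rewrite subr_eq0 eq_sym natrX -(inj_eq (mulfI c0)) -exprS prednK ?(ltn_trans _ p_gt2) //.
by rewrite mulr1 -(pFrobenius_autE charFp) pFrobenius_aut_nat.
Qed.

End CentralPolynomials.

(** * Central polynomials of B *)

Section QuotientByT.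
Variable F : fieldType.
Local Notation A := (freeAlg F).

Fact T_proper : ~ T F 1.
Proof.
move=> T1; pose h : {lrmorphism A -> F^o} := free_hom (fun=> 0).
have h1 : h 1 = 0 by apply: (hom_T _ _ T1) => x y z; exact: mulrC.
by have /eqP := oner_neq0 F; rewrite -(rmorph1 h).
Qed.

Definition T_pred : {pred A} := in_mem^~ (mem (T F)).

Fact T_pred_idealr : idealr_closed T_pred.
Proof.
have [zT TM] := T_ideal F; split; first by apply/mem_set; exact: (zmod_set0 zT).
  by apply/negP => /set_mem; exact: T_proper.
move=> a u v /set_mem Tu /set_mem Tv; apply/mem_set.
exact: (zmod_setD zT (TM a u Tu).1 Tv).
Qed.

HB.instance Definition _ := isIdealr.Build A T_pred T_pred_idealr.

Fact T_pred_rmul : forall a, {in T_pred, forall u, u * a \in T_pred}.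
Proof. by move=> a u /set_mem Tu; apply/mem_set; have [] := (T_ideal F).2 a u Tu. Qed.

HB.instance Definition _ := isRightMulClosed.Build A T_pred T_pred_rmul.

Definition AmodT : algType F := algQuot T_pred.
Definition AmodT_proj : {lrmorphism A -> AmodT} := @algQuot_pi F A T_pred.

Lemma AmodT_projP (x y : A) : AmodT_proj x = AmodT_proj y -> T F (x - y).
Proof. by move/(@algQuot_piP F A T_pred)/set_mem. Qed.

Lemma AmodT_proj_surj (x : AmodT) : exists a, x = AmodT_proj a.
Proof. exists (repr x); symmetry; exact: reprK. Qed.

Lemma AmodT_comm3 (x y z : AmodT) : (x * y - y * x) * z = z * (x * y - y * x).
Proof.
have [a ->] := AmodT_proj_surj x; have [b ->] := AmodT_proj_surj y.
have [c ->] := AmodT_proj_surj z.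
have abc0 : AmodT_proj (comm3 a b c) = AmodT_proj 0.
  by apply/(@algQuot_piP F A T_pred); rewrite subr0; apply/mem_set; exact: T_comm3.
apply: subr0_eq; apply: etrans (esym (rmorph_commutator3E AmodT_proj a b c)) _.
exact: etrans abc0 (rmorph0 _).
Qed.

Variables (p : nat) (charFp : p \in [pchar F]) (p_gt2 : (2 < p)%N).

Lemma algebra_pchar (G : algType F) : p \in [pchar G].
Proof.
by rewrite inE (pcharf_prime charFp) -scaler_nat (pcharf0 charFp) scale0r eqxx.
Qed.

(** Read in the quotient by T, where all triple commutators vanish. *)
Lemma witness_T k z y (x : A) : T F (comm2 (witness p k z y) x).
Proof.
apply: AmodT_projP; rewrite [LHS]rmorphM [RHS]rmorphM rmorph_witness.
exact: (central_witness AmodT_comm3 (algebra_pchar AmodT) p_gt2).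
Qed.

Lemma I_mul k l (f g : A) : I_ F k f -> I_ F l g -> I_ F (k + l) (f * g).
Proof.
move=> /I_P fk /I_P gl; apply/I_P => w /mcoeffM_neq0 [w1 [w2 [-> /fk k1 /gl l2]]].
by rewrite zdegM leq_add.
Qed.

Lemma I_exp k (f : A) : I_ F 1 f -> I_ F k (f ^+ k).
Proof.
move=> f1; elim: k => [|k IH]; first by apply/I_P.
by rewrite exprS; exact: (@I_mul 1 k).
Qed.

Lemma A_odd_I : A_odd F `<=` I_ F 1.
Proof.
move=> x Ax; apply/I_P; move: Ax.
apply: (smallest_sub (supp_submod F (fun w => (1 <= zdeg w)%N))).
move=> _ [w /= zw <-] w'; rewrite [_@__]mcoeffU.
by have [<- _|_] := eqVneq w w'; [case: (zdeg w) zw | rewrite mulr0n eqxx].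
Qed.

Lemma letter_even i : A_even F (letter F (inl i)).
Proof. by apply: sub_gen_smallest; exists (FMonom [:: inl i]). Qed.

Lemma letter_odd j : A_odd F (letter F (inr j)).
Proof. by apply: sub_gen_smallest; exists (FMonom [:: inr j]). Qed.

Lemma evaluate_letter (G : algType F) (g g' : nat -> G) v :
  evaluate g g' (letter F v) = match v with inl i => g i | inr j => g' j end.
Proof. by rewrite /evaluate mmapU /= scale1r mul1r /eval_word /= big_seq1. Qed.

Lemma B_projP (x y : A) : B_proj charFp x = B_proj charFp y <-> U F p (x - y).
Proof.
split; first by move/(@algQuot_piP F A (U_pred charFp))/set_mem.
by move=> Ux; apply/(@algQuot_piP F A (U_pred charFp))/mem_set.
Qed.

Lemma B_proj_surj (x : B charFp) : exists a, x = B_proj charFp a.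
Proof. exists (repr x); symmetry; exact: reprK. Qed.

Definition witness_poly k : A :=
  witness p k (letter F (inr 0%N)) (fun i => letter F (inl i)).

Lemma witness_poly_C2 k : C2 (B_even charFp) (B_odd charFp) (witness_poly k).
Proof.
move=> g g' gE gO x.
have /choice[a aE] : forall i, exists a, B_proj charFp a = g i.
  by move=> i; have [a _ <-] := gE i; exists a.
have [b bO bE] := gO 0%N; have [x' ->] := B_proj_surj x.
have -> : evaluate g g' (witness_poly k) = B_proj charFp (witness p k b a).
  have e1 := rmorph_witness p (evaluate g g') k (letter F (inr 0%N)) (fun i => letter F (inl i)).
  have e2 := rmorph_witness p (B_proj charFp) k b a.
  refine (etrans e1 (etrans _ (esym e2))).
  apply: (congr2 (witness p k)).
    by apply: etrans (evaluate_letter _ _ _) _; exact: esym bE.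
  apply/funext => i; apply: etrans (evaluate_letter _ _ _) _.
  exact: esym (aE i).
rewrite /GRing.comm -!rmorphM; apply/B_projP.
exists (comm2 (witness p k b a) x'); last by exists 0; [exact: zmod_set0 (I_ideal F _).1 | rewrite addr0].
split; first exact: witness_T.
have [zI IM] := I_ideal F p.
have Iw : I_ F p (witness p k b a) := (IM _ _ (@I_exp p _ (A_odd_I bO))).2.
exact: (zmod_setB zI (IM x' _ Iw).2 (IM x' _ Iw).1).
Qed.

Lemma C2_comm f x : C2 (B_even charFp) (B_odd charFp) f -> U F p (comm2 f x).
Proof.
move=> fC2; apply/B_projP.
refine (etrans (rmorphM (B_proj charFp) f x) (etrans _ (esym (rmorphM (B_proj charFp) x f)))).
pose g i := B_proj charFp (letter F (inl i)).
pose g' j := B_proj charFp (letter F (inr j)).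
have E : evaluate g g' f = B_proj charFp f.
  apply: (eq_hom_on (h := evaluate g g') (k := B_proj charFp)) => w v _ _.
  by apply: etrans (evaluate_letter _ _ _) _; case: v.
have gE i : B_even charFp (g i) by exists (letter F (inl i)) => //; exact: letter_even.
have gO j : B_odd charFp (g' j) by exists (letter F (inr j)) => //; exact: letter_odd.
have := fC2 g g' gE gO (B_proj charFp x); rewrite /GRing.comm E; exact.
Qed.

End QuotientByT.

(** * The T2-subalgebra of undetected polynomials *)

Lemma eq_witness p (S : nzRingType) k (z : S) (y y' : nat -> S) :
  (forall i, (i < k.*2)%N -> y i = y' i) -> witness p k z y = witness p k z y'.
Proof.
move=> yy'; congr (_ * _); apply: eq_bigr => i _.
by rewrite !yy' ?ltn_Sdouble // ltn_double.
Qed.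

Lemma lrmorph_sub_scalar (F : fieldType) (R S : algType F) (h : {lrmorphism R -> S})
  (c : F) x : h x = c *: 1 + h (x - c *: 1).
Proof. by rewrite raddfB /= linearZ /= rmorph1 addrC subrK. Qed.

Section Detector.
Variables (F : fieldType) (p k : nat).
Hypotheses (charFp : p \in [pchar F]) (p_gt2 : (2 < p)%N) (k_gt0 : (0 < k)%N).
Local Notation A := (freeAlg F).
Local Notation m := k.*2.+2.
Local Notation Omega := (ext (mpoly.mpoly m F) m).
Local Notation idx i := (inord i : 'I_m).
Local Notation D := (dirs k).
Local Notation top := (top D (top_mon p k)).
Local Notation tau := (poly_form F (idx k.*2) : Omega).

(** All but finitely many letters are sent to zero, and only one odd letter
    survives, without differential: its degree is recorded by powers of tau. *)
Definition letter_form (v : var) : Omega :=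
  match v with
  | inl i => if (i < k.*2)%N then poly_form F (idx i) + ext_gen _ (idx i) else 0
  | inr 0 => tau
  | inr _ => 0
  end.

Definition form_map : {lrmorphism A -> Omega} := free_hom letter_form.

Lemma form_map_letter v : form_map (letter F v) = letter_form v.
Proof. exact: free_hom_letter. Qed.

Lemma top_mon_dirs i : i \in D -> (p %| (top_mon p k i).+1)%N.
Proof.
rewrite inE => ik; rewrite -(inord_val i) (top_monE charFp p_gt2) ?ltn_ord // ik prednK //.
exact: ltn_trans p_gt2.
Qed.

Lemma top_mon_tau : top_mon p k (idx k.*2) = p.
Proof. by rewrite (top_monE charFp p_gt2) ?ltnn ?eqxx ?mul1n // leqW. Qed.

Lemma dirs_even : ~~ odd #|D|.
Proof. by rewrite card_dirs odd_double. Qed.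

Lemma form_map_fedosov f : fedosov D (form_map f).
Proof.
rewrite homE; elim/big_ind: _ => [||w _].
- by rewrite /fedosov !raddf0.
- exact: fedosovD.
apply: fedosovZ; apply: (fedosov_prod charFp p_gt2) => v; rewrite free_hom_letter.
case: v => [i|[|j]] /=; last by rewrite /fedosov !raddf0.
  case: ifP => ik; last by rewrite /fedosov !raddf0.
  by apply: fedosov_even_letter; rewrite inE inordK // leqW // ltnW.
by apply: fedosov_odd_letter; rewrite inE inordK ?ltnn // leqW.
Qed.

Lemma form_map_odd f : A_odd F f -> exists u, form_map f = tau * u.
Proof.
have z_tau j : exists u, form_map (letter F (inr j)) = tau * u.
  rewrite free_hom_letter; case: j => [|j] /=; first by exists 1; rewrite mulr1.
  by exists 0; rewrite mulr0.
by move=> /A_odd_I/(hom_I (poly_formC _) z_tau)[u E]; exists u; rewrite E expr1.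
Qed.

Lemma top_form_scalar (c : F) : top (c *: 1) = 0.
Proof.
by rewrite linearZ /= top1 ?mulr0 // card_dirs double_gt0.
Qed.

(** The constant [c] is carried along because the T_2-subalgebra contains the
    scalars, while the cancellation in products needs the remainder to be
    divisible by tau^p. *)
Definition unseen (c : F) (x : Omega) :=
  (exists u, x = c *: 1 + tau ^+ p * u) /\ top x = 0.

Lemma unseen_top_tau c x u : unseen c x -> x = c *: 1 + tau ^+ p * u ->
  top (tau ^+ p * u) = 0.
Proof. by move=> [_ topx] E; move: topx; rewrite E raddfD /= top_form_scalar add0r. Qed.

Lemma unseen1 : unseen 1 1.
Proof.
split; first by exists 0; rewrite scale1r mulr0 addr0.
by rewrite -[1]scale1r top_form_scalar.
Qed.

Lemma unseenP e c c' x y : unseen c x -> unseen c' y -> unseen (e * c + c') (e *: x + y).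
Proof.
move=> [[u ->] topx] [[v ->] topy]; split; last first.
  by rewrite raddfD /= linearZ /= topx topy mulr0 addr0.
exists (e *: u + v); rewrite scalerDr addrACA scalerA -scalerDl; congr (_ + _).
by rewrite mulrDr scalerAr.
Qed.

(** The product of the two remainders is divisible by tau^(2p), beyond the power
    tau^p that [top] reads; the mixed terms are multiples of the remainders by
    scalars. *)
Lemma unseenM c c' x y : unseen c x -> unseen c' y -> unseen (c * c') (x * y).
Proof.
move=> hx hy; have [[u Ex] topx] := hx; have [[v Ey] topy] := hy.
have prodE (G : algType F) (s r w : G) : s * r = r * s ->
    (c *: 1 + s * r) * (c' *: 1 + s * w) =
    c *: (c' *: 1 + s * w) + (c' *: (s * r) + s * s * (r * w)).
  move=> sr; rewrite mulrDl mulr_algl mulrDr mulr_algr; congr (_ + (_ + _)).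
  by rewrite -!mulrA [r * (s * w)]mulrA -sr -!mulrA.
have tauC : tau ^+ p * u = u * tau ^+ p by rewrite poly_formXC.
have factorE (G : algType F) (s r w z : G) :
    c *: (s * r) + (c' *: (s * w) + s * s * z) = s * (c *: r + (c' *: w + s * z)).
  by rewrite !mulrDr !scalerAr mulrA.
have Exy := prodE _ _ _ v tauC; rewrite -Ex -Ey in Exy.
split.
  exists (c *: v + (c' *: u + tau ^+ p * (u * v))).
  rewrite Exy Ey scalerDr scalerA -addrA; congr (_ + _).
  exact: factorE.
rewrite Exy raddfD /= linearZ /= topy mulr0 add0r raddfD /= linearZ /=.
rewrite (unseen_top_tau hx Ex) mulr0 add0r -exprD; apply: coef_at_poly_form.
by rewrite top_mon_tau; lia.
Qed.

(** Quantifying over all graded endomorphisms makes this set stable under them.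
    *)
Definition undetected : set A :=
  [set f | exists c : F, forall phi : {lrmorphism A -> A}, graded_endo phi ->
     unseen c (form_map (phi f))].

Lemma undetected_T2 : T2_subalgebra undetected.
Proof.
split; first split.
- by apply/mem_set; exists 1 => phi _; rewrite !rmorph1; exact: unseen1.
- move=> e f g /set_mem[c fc] /set_mem[c' gc']; apply/mem_set; exists (e * c + c') => phi gphi.
  rewrite [phi _]linearP [form_map _]linearP.
  exact: unseenP (fc phi gphi) (gc' phi gphi).
- move=> f g /set_mem[c fc] /set_mem[c' gc']; apply/mem_set; exists (c * c') => phi gphi.
  rewrite [phi _]rmorphM [form_map _]rmorphM.
  exact: unseenM (fc phi gphi) (gc' phi gphi).
move=> psi [psi0 psi1] _ [f [c fc] <-]; exists c => phi [phi0 phi1].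
apply: (fc (phi \o psi : {lrmorphism A -> A})).
split=> _ [x Ax <-]; [apply: phi0 | apply: phi1]; exists (psi x) => //.
  by apply: psi0; exists x.
by apply: psi1; exists x.
Qed.

Lemma graded_id : graded_endo (idfun : {lrmorphism A -> A}).
Proof. by split=> _ [x ? <-]. Qed.

Lemma witness_detected : ~ undetected (witness_poly F p k).
Proof.
move=> [c /(_ _ graded_id) [_ /eqP]]; apply/negP.
have E := rmorph_witness p form_map k (letter F (inr 0%N)) (fun i => letter F (inl i)).
have -> : form_map (idfun (witness_poly F p k)) =
    witness p k tau (fun i => poly_form F (idx i) + ext_gen _ (idx i)).
  apply: etrans E (etrans (congr1 (fun z => witness p k z _) (form_map_letter _)) _).
  apply: eq_witness => i ik; apply: etrans (form_map_letter _) _.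
  by rewrite /= ik.
exact: (top_witness_neq0 k charFp p_gt2).
Qed.

Definition var_index (v : var) : nat := match v with inl i => i | inr j => j end.

(** The bound k - 1 leaves room for a letter y of index k - 1 that does not
    occur in [f], and makes the number 2(k - 1) of available letters smaller
    than the number 2k of directions. *)
Lemma central_undetected (f : A) :
  (forall (w : {fmonom var}) v, f@_w != 0 -> v \in (w : seq var) -> (var_index v < k.-1)%N) ->
  (forall x, U F p (comm2 f x)) -> undetected f.
Proof.
move=> fk fU; pose M := k.-1; pose y := letter F (inl M).
pose c := f@_mone; pose g : A := f - c *: 1.
have [x [Tx Ix] [w Iw E]] := fU y.
have fy (v : {fmonom var}) : f@_v != 0 -> inl M \notin (v : seq var).
  by move=> fv; apply/negP => /(fk v _ fv); rewrite ltnn.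
have Ig : I_ F p g.
  apply: (commuting_I fy) => //; rewrite -/y -E.
  apply: (zmod_setD (I_ideal F p).1 Ix); apply/I_P => v.
  by move/I_P: Iw => + vw => /(_ v vw) /ltnW.
have acg : almost_central p y g.
  exists x, w; split; [exact: Tx | exact: Iw |]; rewrite E /g.
  have -> : comm2 (f - c *: 1) y = comm2 f y - comm2 (c *: 1) y by exact: commutatorBl.
  have -> : comm2 (c *: 1) y = 0 by rewrite /comm2 mulr_algl mulr_algr subrr.
  by rewrite subr0.
pose vs : seq var := map inl (iota 0 M) ++ map inr (iota 0 M).
have inl_inj : injective (@inl nat nat) by move=> i j [].
have inr_inj : injective (@inr nat nat) by move=> i j [].
have notin_inr i : inl i \in map (@inr nat nat) (iota 0 M) = false.
  by apply/negP => /mapP[].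
have notin_inl i : inr i \in map (@inl nat nat) (iota 0 M) = false.
  by apply/negP => /mapP[].
have vsE v : (v \in vs) = (var_index v < M)%N.
  rewrite mem_cat; case: v => i.
    by rewrite (mem_map inl_inj) notin_inr orbF mem_iota.
  by rewrite (mem_map inr_inj) notin_inl mem_iota.
have uniq_vs : uniq vs.
  rewrite cat_uniq (map_inj_uniq inl_inj) (map_inj_uniq inr_inj) !iota_uniq andbT.
  by apply/hasPn => _ /mapP[i _ ->]; rewrite notin_inl.
exists c => phi gphi; pose h : {lrmorphism A -> Omega} := form_map \o phi.
have h_tau j : exists u, h (letter F (inr j)) = tau * u.
  by apply: form_map_odd; apply: gphi.2; exists (letter F (inr j)) => //; exact: letter_odd.
have h_fedosov v : fedosov D (h (letter F v)) by exact: form_map_fedosov.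
have hf : h f = c *: 1 + h g := lrmorph_sub_scalar h c f.
split.
  have [u Eu] := hom_I (poly_formC _) h_tau Ig; exists u; rewrite -Eu.
  exact: hf.
rewrite -[form_map (phi f)]/(h f) hf raddfD /= top_form_scalar add0r.
have tD : idx k.*2 \notin D by rewrite inE inordK ?ltnn // leqW.
have oD : (ord_max : 'I_m) \notin D by rewrite inE /= -leqNgt leqW.
apply: (@top_central _ _ _ charFp p_gt2 D (top_mon p k) (idx k.*2) (idx k.*2) ord_max
   top_mon_dirs top_mon_tau dirs_even tD oD _ h h_fedosov h_tau M vs g uniq_vs).
- by rewrite -val_eqE /= inordK //; lia.
- by rewrite card_dirs size_cat !size_map size_iota addnn ltn_double prednK.
- by rewrite vsE /= ltnn.
- move=> v gv u uv; rewrite vsE; apply: (fk v) => //; move: gv.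
  have [v1|v1] := eqVneq v mone; first by move: uv; rewrite v1 fm1.
  by rewrite mcoeffB mcoeffZ mcoeff1 (negPf v1) mulr0 subr0.
exact: acg.
Qed.

End Detector.

Lemma finite_letters (F : fieldType) (S : set (freeAlg F)) : finite_set S ->
  exists M, forall (f : freeAlg F), S f -> forall (w : {fmonom var}) v,
    f@_w != 0 -> v \in (w : seq var) -> (var_index v < M)%N.
Proof.
move=> /finite_seqP[s ->].
have wordM (w : {fmonom var}) : exists M, forall v, v \in (w : seq var) -> (var_index v < M)%N.
  exists (\max_(v <- (w : seq var)) var_index v).+1 => v vw.
  by rewrite ltnS (big_rem v) //= leq_maxl.
have polyM (f : freeAlg F) : exists M, forall (w : {fmonom var}) v,
    f@_w != 0 -> v \in (w : seq var) -> (var_index v < M)%N.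
  have /choice[b bP] := wordM; exists (\max_(w <- msupp f) b w)%N => w v fw vw.
  apply: leq_trans (bP w v vw) _.
  by rewrite (big_rem w) ?leq_maxl // -mcoeff_neq0.
have /choice[b bP] := polyM; exists (\max_(f <- s) b f)%N => f fs w v fw vw.
by apply: leq_trans (bP f w v fw vw) _; rewrite (big_rem f) ?leq_maxl.
Qed.

(** Choose k larger by one than a bound on the letters of the finite generating
    set; the polynomial [witness_poly] in 2k variables is then out of reach. *)
Theorem theorem1 (F : fieldType) (p : nat) (charFp : p \in [pchar F]%R)
    (F_infinite : infinite_set [set: F]) (p_gt2 : (2 < p)%N) :
  ~ T2_finitely_generated (C2 (B_even charFp) (B_odd charFp)).
Proof.
move=> [S [/finite_letters[M SM] SC2 genS]].
have sub : C2 (B_even charFp) (B_odd charFp) `<=` @undetected F p M.+1.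
  rewrite -genS; apply: smallest_sub; first exact: undetected_T2.
  move=> f Sf; apply: central_undetected => // [w v|x]; first exact: SM.
  by apply: C2_comm; exact: SC2.
exact: (witness_detected charFp p_gt2 (sub _ (@witness_poly_C2 F p charFp p_gt2 M.+1))).
Qed.
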